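(* Let $S[1\mathinner{.\,.}n]$ have an $\alpha$-contracting parse with $t$ phrases, for some $\alpha\le w^{O(1)}$, where $w$ is the machine word size. Then there exists a data structure of size $O(t)$ words that, given any position $q\in[1,n]$, returns $S[q]$ in time $O(h_q+\log_w\ell_q)$, where $h_q$ is the height of $S[q]$ in the parse and $\ell_q$ is the length of the longest repeated substring of $S$ containing position $q$.
   Context: Model: transdichotomous word RAM with word size $w\ge\log n$; space in machine words. A parse cuts $S$ into consecutive substrings (phrases) $S=B_1\cdots B_t$, where phrase $B_i$ starts at position $x_i$ ($x_1=1$, $x_{t+1}=n+1$). Each phrase is either explicit (stored literally, of length $O(\log_\sigma n)$ where $\sigma$ is the alphabet size, fitting in $O(1)$ words) or a copy of another substring $S[p_i\mathinner{.\,.}p_i+|B_i|-1]=B_i$, called its source. Define $f(q)=q$ if $q$ lies in an explicit phrase, and $f(q)=p_i+q-x_i$ if $q$ lies in non-explicit phrase $B_i$. The parse is valid (decodable) if iterating $f$ from any $q$ eventually reaches a position inside an explicit phrase; the height $h_q$ of $S[q]$ is the number of applications of $f$ needed to reach such a position. A parse is $\alpha$-contracting if no source overlaps a phrase that is strictly more than $\alpha$ times longer than the source. $\ell_q$ is the maximum length of a substring $S[i\mathinner{.\,.}j]$ with $i\le q\le j$ occurring at least twice in $S$ (at distinct starting positions). Convention: $\log_b x$ denotes $\max(1,\log_b x)$. *)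

(* Defs.v *)
(* Stdlib world: nat for positions and lengths, N for machine words, R for bounds. *)
From Stdlib Require Import Arith NArith List Reals.
Import ListNotations.

Local Open Scope nat_scope.

(** * Strings, positions 1..n *)

Definition char (S : list nat) (q : nat) : nat := nth (q - 1) S 0.

(* [i .. i+len-1] and [j .. j+len-1] lie inside [1 .. n] and spell the same string. *)
Definition same_substring (S : list nat) (i j len : nat) : Prop :=
  1 <= i /\ i + len <= length S + 1 /\
  1 <= j /\ j + len <= length S + 1 /\
  forall k, k < len -> char S (i + k) = char S (j + k).

Definition repeated (S : list nat) (i j : nat) : Prop :=
  i <= j /\ exists i', i' <> i /\ same_substring S i i' (j + 1 - i).

(* [l] is the maximum length of a repeated substring containing [q]; it is 0
   when no repeated substring contains [q]. *)
Definition longest_repeat (S : list nat) (q l : nat) : Prop :=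
  (forall i j, i <= q <= j -> repeated S i j -> j + 1 - i <= l) /\
  (l = 0 \/ exists i j, i <= q <= j /\ repeated S i j /\ l = j + 1 - i).

(* max(1, log_b x); Stdlib's [ln] is 0 on nonpositive numbers, so the value is
   1 at x = 0. *)
Definition log (b x : nat) : R := Rmax 1 (ln (INR x) / ln (INR b)).

(** * Parses *)

(* Phrase i (1 <= i <= nphrases) is [start i .. start (i+1) - 1]; it is
   explicit if [source i] is [None], and copied from position p if it is
   [Some p].  The values of both functions at other indices are irrelevant. *)
Record parse := Parse {
  nphrases : nat;
  start : nat -> nat;
  source : nat -> option nat
}.

Definition phrase_index (P : parse) (i : nat) : Prop := 1 <= i <= nphrases P.

Definition phrase_len (P : parse) (i : nat) : nat := start P (i + 1) - start P i.

Definition in_phrase (P : parse) (i q : nat) : Prop :=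
  start P i <= q < start P (i + 1).

(* [C] is the constant hidden in the O(log_sigma n) bound on explicit phrases. *)
Definition is_parse (C : R) (sigma : nat) (S : list nat) (P : parse) : Prop :=
  start P 1 = 1 /\
  start P (nphrases P + 1) = length S + 1 /\
  (forall i, phrase_index P i -> start P i < start P (i + 1)) /\
  (forall i, phrase_index P i ->
     match source P i with
     | None => (INR (phrase_len P i) <= C * log sigma (length S))%R
     | Some p => same_substring S p (start P i) (phrase_len P i)
     end).

(* The index of the phrase containing [q], as the number of phrases starting
   at or before [q]. *)
Definition phrase_of (P : parse) (q : nat) : nat :=
  length (filter (fun i => start P i <=? q) (seq 1 (nphrases P))).

Definition explicit_pos (P : parse) (q : nat) : Prop :=
  source P (phrase_of P q) = None.

Definition parse_step (P : parse) (q : nat) : nat :=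
  match source P (phrase_of P q) with
  | None => q
  | Some p => p + q - start P (phrase_of P q)
  end.

Definition height (P : parse) (q h : nat) : Prop :=
  explicit_pos P (Nat.iter h (parse_step P) q) /\
  forall k, k < h -> ~ explicit_pos P (Nat.iter k (parse_step P) q).

Definition valid_parse (S : list nat) (P : parse) : Prop :=
  forall q, 1 <= q <= length S ->
    exists k, explicit_pos P (Nat.iter k (parse_step P) q).

Definition contracting (alpha : R) (P : parse) : Prop :=
  forall i p j r,
    phrase_index P i -> source P i = Some p -> phrase_index P j ->
    p <= r < p + phrase_len P i -> in_phrase P j r ->
    (INR (phrase_len P j) <= alpha * INR (phrase_len P i))%R.

(** * Word RAM queries *)

(* Query algorithms are while-programs over word registers; these simulate
   RAM programs with jumps, and conversely, with constant overhead.  A program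
   mentions finitely many registers, so its working space is O(1) words.  The
   data structure is read-only and made of arrays of words that a program
   names statically, so that each of them is addressable by one word even if
   the total number O(t) of words exceeds 2^w. *)

Inductive binop :=
| Add | Sub | Mul | Div | Mod | And | Or | Xor | Shl | Shr | Equal | Less.

Inductive prog :=
| Skip
| Const (d : nat) (c : N)
| Op (d : nat) (o : binop) (x y : nat)
| Fetch (d : nat) (arr : nat) (a : nat)
| Seq (p1 p2 : prog)
| If (x : nat) (p1 p2 : prog)
| While (x : nat) (p : prog).

Definition memory := list (list N).
Definition registers := nat -> N.

Definition is_word (w : nat) (v : N) : Prop := (v < 2 ^ N.of_nat w)%N.

Definition memory_ok (w : nat) (M : memory) : Prop :=
  Forall (Forall (is_word w)) M.

Definition memory_size (M : memory) : nat := list_sum (map (@length N) M).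

Definition read (M : memory) (arr : nat) (a : N) : option N :=
  nth_error (nth arr M []) (N.to_nat a).

Definition set_reg (rho : registers) (d : nat) (v : N) : registers :=
  fun x => if x =? d then v else rho x.

Definition eval_op (w : nat) (o : binop) (x y : N) : N :=
  let m := (2 ^ N.of_nat w)%N in
  (match o with
   | Add => (x + y) mod m
   | Sub => (x + m - y) mod m
   | Mul => (x * y) mod m
   | Div => x / y
   | Mod => x mod y
   | And => N.land x y
   | Or => N.lor x y
   | Xor => N.lxor x y
   | Shl => N.shiftl x y mod m
   | Shr => N.shiftr x y
   | Equal => if x =? y then 1 else 0
   | Less => if x <? y then 1 else 0
   end)%N.

(* [exec w M p rho rho' T]: started in [rho], [p] halts in [rho'] after [T]
   unit-cost operations (assignments, fetches, tests).  A fetch outside an array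
   has no transition. *)
Inductive exec (w : nat) (M : memory) :
  prog -> registers -> registers -> nat -> Prop :=
| exec_skip rho : exec w M Skip rho rho 0
| exec_const d c rho :
    exec w M (Const d c) rho (set_reg rho d (c mod 2 ^ N.of_nat w)%N) 1
| exec_op d o x y rho :
    exec w M (Op d o x y) rho (set_reg rho d (eval_op w o (rho x) (rho y))) 1
| exec_fetch d arr a v rho :
    read M arr (rho a) = Some v ->
    exec w M (Fetch d arr a) rho (set_reg rho d v) 1
| exec_seq p1 p2 rho1 rho2 rho3 T1 T2 :
    exec w M p1 rho1 rho2 T1 -> exec w M p2 rho2 rho3 T2 ->
    exec w M (Seq p1 p2) rho1 rho3 (T1 + T2)
| exec_if_true x p1 p2 rho rho' T :
    rho x <> 0%N -> exec w M p1 rho rho' T ->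
    exec w M (If x p1 p2) rho rho' (T + 1)
| exec_if_false x p1 p2 rho rho' T :
    rho x = 0%N -> exec w M p2 rho rho' T ->
    exec w M (If x p1 p2) rho rho' (T + 1)
| exec_while_true x p rho1 rho2 rho3 T1 T2 :
    rho1 x <> 0%N -> exec w M p rho1 rho2 T1 ->
    exec w M (While x p) rho2 rho3 T2 ->
    exec w M (While x p) rho1 rho3 (T1 + T2 + 1)
| exec_while_false x p rho :
    rho x = 0%N -> exec w M (While x p) rho rho 1.

(* The input is placed in register 0 and the other registers are 0; the output
   is read from register 0. *)
Definition returns (w : nat) (M : memory) (p : prog) (input output : N) (T : nat)
  : Prop :=
  exists rho', exec w M p (set_reg (fun _ => 0%N) 0 input) rho' T /\
               rho' 0 = output.

(* Position [q] is passed as [q - 1], since q = n may be 2^w when w = log n. *)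
Definition access (w : nat) (M : memory) (p : prog) (S : list nat) (q T : nat)
  : Prop :=
  returns w M p (N.of_nat (q - 1)) (N.of_nat (char S q)) T.

(* Main.v *)
Require Import Defs.
From Stdlib Require Import Arith NArith List Reals Lia Lra Bool.
Import ListNotations Defs.

Local Open Scope nat_scope.

(** Let B = 2^beta with beta * B <= w < B^3, and let a phrase of length l have
    level about log_B l.  Phrases of level k are at least B^k long, so at most
    one of them starts in each aligned cell of width B^k.  A block of B cells
    meeting a phrase of level k gets an entry in a perfect hash table: one word
    packs, for every cell, the number of phrases of level k starting in the block
    before that cell.  This locates in O(1) time the phrase containing a position, provided
    its level is known.  A query tries the levels upwards until it finds the
    first phrase, of length at most l_q or O(w); after each jump to a source it
    tries the levels downwards, starting O(1) above the level of the phrase left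
    behind, which suffices because the parse is contracting.  The number of
    levels tried telescopes to O(h_q + log_w l_q).  Lookups need no key
    verification, since the phrase found is checked to contain the position. *)

(** * Counting in lists *)

(** The two conditions on beta pull in opposite directions: beta * B <= w lets B counters of beta
    bits share a word, while w < B^3 makes log_B at most three times log_w and turns a factor w^c in
    length into at most 3c levels. Space O(t) rests on a phrase of level k being at most B^(k+1)
    long, the width of one block, so that it meets at most two blocks. Counting starts leaves one
    ambiguity, whether the phrase starts in the cell of the position or earlier; hence two
    consecutive candidates are tested. As n may equal 2^w while keys, positions and slots must fit
    one word, positions are counted from 0, lengths enter as len - 1, and the hash table may not
    exceed 2^w slots. One program serves every w: constants depending on w are read from one-word
    arrays. Hash multipliers are shown to exist by averaging over the odd words. *)

Lemma list_sum_map_le {A} (f g : A -> nat) l :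
  (forall x, In x l -> f x <= g x) ->
  list_sum (map f l) <= list_sum (map g l).
Proof.
  induction l as [|x l IH]; simpl; intros H; [lia|].
  specialize (IH (fun y Hy => H y (or_intror Hy))).
  specialize (H x (or_introl eq_refl)). lia.
Qed.

Lemma list_sum_map_ext {A} (f g : A -> nat) l :
  (forall x, In x l -> f x = g x) ->
  list_sum (map f l) = list_sum (map g l).
Proof. intros H. f_equal. now apply map_ext_in. Qed.

Lemma list_sum_map_add {A} (f g : A -> nat) l :
  list_sum (map (fun x => f x + g x) l) =
  list_sum (map f l) + list_sum (map g l).
Proof. induction l; simpl; lia. Qed.

Lemma list_sum_map_mul {A} (f : A -> nat) k l :
  list_sum (map (fun x => k * f x) l) = k * list_sum (map f l).
Proof. induction l; simpl; lia. Qed.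

Lemma list_sum_map_const {A} k (l : list A) :
  list_sum (map (fun _ => k) l) = k * length l.
Proof. induction l; simpl; lia. Qed.

Lemma list_sum_swap {A B} (f : A -> B -> nat) l l' :
  list_sum (map (fun x => list_sum (map (f x) l')) l) =
  list_sum (map (fun y => list_sum (map (fun x => f x y) l)) l').
Proof.
  induction l as [|x l IH]; simpl.
  - rewrite list_sum_map_const. lia.
  - rewrite IH, <- list_sum_map_add. reflexivity.
Qed.

Lemma length_filter_sum {A} (p : A -> bool) l :
  length (filter p l) = list_sum (map (fun x => Nat.b2n (p x)) l).
Proof. induction l as [|x l IH]; simpl; [|destruct (p x)]; simpl; lia. Qed.

Lemma exists_le_average {A} (f : A -> nat) k l :
  l <> [] -> list_sum (map f l) <= k * length l ->
  exists x, In x l /\ f x <= k.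
Proof.
  induction l as [|x l IH]; simpl; intros Hl H; [congruence|].
  destruct (le_lt_dec (f x) k) as [Hx|Hx]; [eauto|].
  destruct l as [|y l]; [simpl in *; lia|].
  destruct IH as (z & Hz & Hle); [congruence|lia|eauto].
Qed.

Lemma list_sum_zero {A} (f : A -> nat) l x :
  list_sum (map f l) = 0 -> In x l -> f x = 0.
Proof.
  induction l as [|y l IH]; simpl; intros H Hx; [easy|].
  destruct Hx as [->|Hx]; [lia|]. apply IH; [lia|easy].
Qed.

Lemma list_sum_indicator g m n i :
  m <= i < m + n ->
  list_sum (map (fun j => Nat.b2n (i =? j) * g j) (seq m n)) = g i.
Proof.
  revert m; induction n as [|n IH]; intros m H; [lia|]; simpl.
  destruct (Nat.eqb_spec i m) as [->|Hne].
  - rewrite (list_sum_map_ext _ (fun _ => 0)).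
    + rewrite list_sum_map_const; simpl; lia.
    + intros j Hj%in_seq. destruct (Nat.eqb_spec m j); simpl; lia.
  - rewrite IH; simpl; lia.
Qed.

Lemma list_sum_by_class {A} (h : A -> nat) g m l :
  (forall x, In x l -> h x < m) ->
  list_sum (map (fun i => length (filter (fun x => h x =? i) l) * g i) (seq 0 m)) =
  list_sum (map (fun x => g (h x)) l).
Proof.
  intros Hm.
  rewrite (list_sum_map_ext _
    (fun i => list_sum (map (fun x => Nat.b2n (h x =? i) * g i) l))).
  - rewrite list_sum_swap. apply list_sum_map_ext. intros x Hx.
    apply list_sum_indicator. specialize (Hm x Hx). lia.
  - intros i _. rewrite length_filter_sum, Nat.mul_comm, <- list_sum_map_mul.
    apply list_sum_map_ext. intros; lia.
Qed.

Lemma length_filter_remove {A} (dec : forall x y : A, {x = y} + {x <> y})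
  (p : A -> bool) l x :
  NoDup l -> In x l -> p x = true ->
  length (filter p l) =
  S (length (filter (fun y => negb (if dec x y then true else false) && p y) l)).
Proof.
  induction l as [|y l IH]; simpl; intros Hnd Hx Hp; [easy|].
  inversion Hnd as [|? ? Hy Hnd']; subst.
  destruct Hx as [->|Hx].
  - rewrite Hp. destruct (dec x x); [simpl|congruence].
    do 2 f_equal. apply filter_ext_in. intros z Hz.
    destruct (dec x z); [congruence|easy].
  - destruct (dec x y) as [->|]; [easy|]; simpl.
    destruct (p y); simpl; rewrite IH; auto.
Qed.

Lemma length_le_injection {A B} (f : A -> B) l l' :
  NoDup l -> (forall x, In x l -> In (f x) l') ->
  (forall x y, In x l -> In y l -> f x = f y -> x = y) ->
  length l <= length l'.
Proof.
  intros Hnd Hin Hinj. rewrite <- (length_map f l).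
  apply NoDup_incl_length.
  - apply NoDup_map_NoDup_ForallPairs; auto.
  - intros y (x & <- & Hx)%in_map_iff. auto.
Qed.

Lemma NoDup_list_prod {A B} (l : list A) (l' : list B) :
  NoDup l -> NoDup l' -> NoDup (list_prod l l').
Proof.
  intros Hl Hl'. induction Hl as [|x l Hx _ IH]; simpl; [constructor|].
  apply NoDup_app; [|easy|].
  - apply NoDup_map_NoDup_ForallPairs; [|easy]. intros y z _ _ E. congruence.
  - intros [x' y] (y' & [= <- <-] & _)%in_map_iff Hin%in_prod_iff. tauto.
Qed.

Lemma finite_choice {A} (a0 : A) (R : nat -> A -> Prop) n :
  (forall i, i < n -> exists a, R i a) ->
  exists f, forall i, i < n -> R i (f i).
Proof.
  induction n as [|n IH]; intros H.
  - exists (fun _ => a0). lia.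
  - destruct IH as [f Hf]; [intros; apply H; lia|].
    destruct (H n) as [a Ha]; [lia|].
    exists (fun i => if i =? n then a else f i). intros i Hi.
    destruct (Nat.eqb_spec i n) as [->|]; [easy|apply Hf; lia].
Qed.

(** * Multiply-shift hashing *)

(** These are the top [w - sh] bits of the low word of the product: one multiplication and one shift
    of the machine. *)
Definition hash (w a sh x : nat) : nat := a * x mod 2 ^ w / 2 ^ sh.

Lemma pow2_pos n : 0 < 2 ^ n.
Proof. pose proof (Nat.pow_nonzero 2 n). lia. Qed.

Lemma hash_lt w a sh x : sh <= w -> hash w a sh x < 2 ^ (w - sh).
Proof.
  intros H. unfold hash.
  apply Nat.Div0.div_lt_upper_bound. rewrite <- Nat.pow_add_r.
  replace (sh + (w - sh)) with w by lia.
  apply Nat.mod_upper_bound. pose proof (pow2_pos w). lia.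
Qed.

(** The inverse is lifted one bit at a time: when [q] is odd, adding 2^w to [u] adds the odd [z] to
    [q] and makes it even. *)
Lemma odd_inverse w z : Nat.Odd z -> exists u q, u * z = 1 + 2 ^ w * q.
Proof.
  intros [z' ->]. induction w as [|w (u & q & H)].
  - exists 1, (2 * z'). simpl. lia.
  - destruct (Nat.Even_or_Odd q) as [[q' ->]|[q' ->]].
    + exists u, q'. rewrite H. simpl. lia.
    + exists (u + 2 ^ w), (q' + z' + 1). rewrite Nat.mul_add_distr_r, H. simpl. lia.
Qed.

Lemma odd_part d : 0 < d -> exists i z, d = 2 ^ i * z /\ Nat.Odd z.
Proof.
  induction d as [d IH] using (well_founded_induction lt_wf). intros Hd.
  destruct (Nat.Even_or_Odd d) as [[d' ->]|Hodd].
  - destruct (IH d') as (i & z & -> & Hz); [lia|lia|].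
    exists (S i), z. split; [simpl; lia|easy].
  - exists 0, d. split; [simpl; lia|easy].
Qed.

(** An odd multiplier never sends a nonzero difference of keys to 0 modulo 2^w, whereas an even one
    may merge two keys outright. *)
Definition odds (w : nat) : list nat := map (fun u => 2 * u + 1) (seq 0 (2 ^ (w - 1))).

Lemma in_odds w a : 1 <= w -> In a (odds w) <-> a < 2 ^ w /\ Nat.Odd a.
Proof.
  intros Hw. unfold odds. rewrite in_map_iff.
  assert (Hp : 2 ^ w = 2 * 2 ^ (w - 1))
    by (rewrite <- Nat.pow_succ_r'; f_equal; lia).
  split.
  - intros (u & <- & Hu%in_seq). split; [lia|now exists u].
  - intros [Hlt [u ->]]. exists u. split; [easy|]. apply in_seq. lia.
Qed.

Lemma odds_NoDup w : NoDup (odds w).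
Proof.
  apply NoDup_map_NoDup_ForallPairs; [|apply seq_NoDup]. intros x y _ _. lia.
Qed.

Lemma odds_length w : length (odds w) = 2 ^ (w - 1).
Proof. unfold odds. now rewrite length_map, length_seq. Qed.

(* Multiples of an even [y] with [y * d = 2^sh] modulo 2^w translate the set of odd [a] with
   [a * d] in the lowest of the 2^(w-sh) windows of width 2^sh to the
   analogous sets for the other windows. *)
Lemma window_count w sh d :
  1 <= w -> sh <= w -> 0 < d < 2 ^ w ->
  2 ^ (w - sh) * length (filter (fun a => a * d mod 2 ^ w <? 2 ^ sh) (odds w))
  <= 2 ^ (w - 1).
Proof.
  intros Hw Hsh [Hd0 Hd].
  pose proof (pow2_pos w) as HM. pose proof (pow2_pos sh) as HV.
  assert (Hsplit : 2 ^ w = 2 ^ sh * 2 ^ (w - sh))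
    by (rewrite <- Nat.pow_add_r; f_equal; lia).
  destruct (odd_part d Hd0) as (i & z & Hdz & Hz).
  assert (Hi : i < w).
  { apply (Nat.pow_lt_mono_r_iff 2); [lia|]. destruct Hz as [z' ->]. nia. }
  destruct (le_lt_dec sh i) as [Hle|Hlt].
  (* Here 2^sh divides [d], so for odd [a] the product modulo 2^w is a nonzero multiple of 2^i >=
     2^sh: the lowest window is empty. *)
  - enough (E : filter (fun a => a * d mod 2 ^ w <? 2 ^ sh) (odds w) = [])
      by (rewrite E; simpl; lia).
    destruct (filter _ _) as [|a l] eqn:E; [easy|exfalso].
    assert (Ha : In a (a :: l)) by (left; easy). rewrite <- E in Ha.
    apply filter_In in Ha as [Ha Hlt%Nat.ltb_lt].
    apply in_odds in Ha as [_ Hodd]; [|easy].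
    assert (Hw' : 2 ^ w = 2 ^ i * 2 ^ (w - i))
      by (rewrite <- Nat.pow_add_r; f_equal; lia).
    assert (Hle' : 2 ^ sh <= 2 ^ i) by (apply Nat.pow_le_mono_r; lia).
    replace (a * d) with (2 ^ i * (a * z)) in Hlt by (rewrite Hdz; ring).
    rewrite Hw', Nat.Div0.mul_mod_distr_l in Hlt.
    assert (Hr : (a * z) mod 2 ^ (w - i) = 0) by nia.
    assert (Hodd' : Nat.Odd (a * z)) by now apply Nat.Odd_mul.
    apply Nat.Div0.div_exact in Hr.
    replace (2 ^ (w - i)) with (2 * 2 ^ (w - i - 1)) in Hr
      by (rewrite <- Nat.pow_succ_r'; f_equal; lia).
    destruct Hodd' as [k Hk]. rewrite <- Nat.mul_assoc in Hr. lia.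
  - destruct (odd_inverse w z Hz) as (u & q & Hu).
    (* [u] inverts the odd part of [d], so [y] is 2^(sh-i) times that inverse. The factor 2,
       available as i < sh, keeps [a + t * y] odd. *)
    set (y := 2 * 2 ^ (sh - i - 1) * u).
    assert (Hy : y * d = 2 ^ sh + 2 ^ w * (2 ^ sh * q)).
    { subst y. rewrite Hdz.
      replace (2 * 2 ^ (sh - i - 1) * u * (2 ^ i * z))
        with (2 ^ (sh - i - 1) * 2 ^ S i * (u * z)) by (simpl; ring).
      rewrite <- Nat.pow_add_r, Hu.
      replace (sh - i - 1 + S i) with sh by lia. ring. }
    rewrite <- odds_length, Nat.mul_comm, <- (length_seq (2 ^ (w - sh)) 0), <- length_prod.
    set (W := filter _ _).
    assert (HW : forall a, In a W -> a < 2 ^ w /\ Nat.Odd a /\ a * d mod 2 ^ w < 2 ^ sh).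
    { intros a [Ha Hlt'%Nat.ltb_lt]%filter_In. apply in_odds in Ha; tauto. }
    assert (Hval : forall a t, In a W -> t < 2 ^ (w - sh) ->
      ((a + t * y) mod 2 ^ w) * d mod 2 ^ w = a * d mod 2 ^ w + t * 2 ^ sh).
    { intros a t Ha Ht. destruct (HW a Ha) as (_ & _ & Hwin).
      rewrite Nat.Div0.mul_mod_idemp_l.
      replace ((a + t * y) * d) with (a * d + t * (y * d)) by ring.
      rewrite Hy, (Nat.div_mod_eq (a * d) (2 ^ w)) at 1.
      replace (_ + _ + _) with
        (a * d mod 2 ^ w + t * 2 ^ sh + (a * d / 2 ^ w + t * (2 ^ sh * q)) * 2 ^ w) by ring.
      rewrite Nat.Div0.mod_add. apply Nat.mod_small. nia. }
    (* The image times [d] is [a * d mod 2^w + t * 2^sh]: its window reveals [t], and undoing the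
       translation recovers [a]. *)
    apply (length_le_injection (fun p => (fst p + snd p * y) mod 2 ^ w)).
    + apply NoDup_list_prod; [apply NoDup_filter, odds_NoDup|apply seq_NoDup].
    + intros [a t] [Ha Ht]%in_prod_iff; simpl.
      destruct (HW a Ha) as (_ & Hodd & _).
      apply in_odds; [easy|]. split; [apply Nat.mod_upper_bound; lia|].
      replace (2 ^ w) with (2 * 2 ^ (w - 1))
        by (rewrite <- Nat.pow_succ_r'; f_equal; lia).
      rewrite Nat.Div0.mod_mul_r. destruct Hodd as [a' ->]. subst y.
      replace (2 * a' + 1 + t * (2 * 2 ^ (sh - i - 1) * u))
        with (1 + (a' + t * (2 ^ (sh - i - 1) * u)) * 2) by ring.
      rewrite Nat.Div0.mod_add. simpl (1 mod 2). eexists. rewrite Nat.add_comm. reflexivity.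
    + intros [a t] [a' t'] [Ha Ht]%in_prod_iff [Ha' Ht']%in_prod_iff; simpl.
      intros Heq. apply in_seq in Ht, Ht'.
      pose proof (Hval a t Ha ltac:(lia)) as E1.
      pose proof (Hval a' t' Ha' ltac:(lia)) as E2.
      rewrite Heq, E2 in E1.
      destruct (HW a Ha) as (Hlt1 & _ & Hw1). destruct (HW a' Ha') as (Hlt2 & _ & Hw2).
      assert (t = t') as <- by nia.
      f_equal.
      rewrite <- (Nat.mod_small a (2 ^ w)), <- (Nat.mod_small a' (2 ^ w)) by easy.
      assert (Hback : forall b, (b + t * y + t * y * (2 ^ w - 1)) mod 2 ^ w = b mod 2 ^ w).
      { intros b. replace (_ + _ + _) with (b + t * y * 2 ^ w) by nia.
        apply Nat.Div0.mod_add. }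
      rewrite <- (Hback a), <- (Hback a'),
        <- (Nat.Div0.add_mod_idemp_l (a + t * y)),
        <- (Nat.Div0.add_mod_idemp_l (a' + t * y)), Heq. reflexivity.
Qed.

Lemma same_window_mod M V X Y :
  0 < V -> 0 < M -> X / V = Y / V -> Y <= X < M -> (X + (M - Y)) mod M < V.
Proof.
  intros HV HM H [HYX HX].
  replace (X + (M - Y)) with (X - Y + 1 * M) by lia.
  rewrite Nat.Div0.mod_add, Nat.mod_small by lia.
  pose proof (Nat.div_mod_eq X V) as EX. pose proof (Nat.div_mod_eq Y V) as EY.
  pose proof (Nat.mod_upper_bound X V). rewrite H in EX. lia.
Qed.

(** Products in a common window differ by less than its width, and their difference is [a] times the
    difference of the keys modulo 2^w. *)
Lemma collision_window w a sh x y :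
  x < 2 ^ w -> y < 2 ^ w -> hash w a sh x = hash w a sh y ->
  a * y mod 2 ^ w <= a * x mod 2 ^ w ->
  a * ((x + (2 ^ w - y)) mod 2 ^ w) mod 2 ^ w < 2 ^ sh.
Proof.
  intros Hx Hy Hh Hle. pose proof (pow2_pos w) as HM.
  pose proof (Nat.mod_upper_bound (a * x) (2 ^ w) ltac:(lia)) as Hbx.
  pose proof (same_window_mod _ _ _ _ (pow2_pos sh) HM Hh (conj Hle Hbx)) as Hlt.
  rewrite Nat.Div0.mul_mod_idemp_r, Nat.mul_add_distr_l.
  replace ((a * x + a * (2 ^ w - y)) mod 2 ^ w)
    with ((a * x mod 2 ^ w + (2 ^ w - a * y mod 2 ^ w)) mod 2 ^ w); [easy|].
  rewrite Nat.Div0.add_mod_idemp_l.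
  pose proof (Nat.div_mod_eq (a * y) (2 ^ w)) as Ey.
  pose proof (Nat.mod_upper_bound (a * y) (2 ^ w) ltac:(lia)) as Hby.
  (* With these multiples of 2^w both arguments equal [a * x + (a + 2) * 2^w - (a * y mod 2^w)]. *)
  rewrite <- (Nat.Div0.mod_add _ (a + 1)), <- (Nat.Div0.mod_add (_ + a * _) (a * y / 2 ^ w + 2)).
  f_equal.
  assert (a * (2 ^ w - y) = a * 2 ^ w - a * y) by nia.
  assert (a * y <= a * 2 ^ w) by nia.
  nia.
Qed.

(** A collision sends x - y or y - x, modulo 2^w, to the lowest window, according to which product
    is larger; each case contributes one unit of the factor 2. *)
Lemma collision_count w sh x y :
  1 <= w -> sh <= w -> x < 2 ^ w -> y < 2 ^ w -> x <> y ->
  2 ^ (w - sh) * length (filter (fun a => hash w a sh x =? hash w a sh y) (odds w))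
  <= 2 * 2 ^ (w - 1).
Proof.
  intros Hw Hsh Hx Hy Hne. pose proof (pow2_pos w) as HM.
  assert (Hdiff : forall x y, x < 2 ^ w -> y < 2 ^ w -> x <> y ->
            0 < (x + (2 ^ w - y)) mod 2 ^ w < 2 ^ w).
  { clear - HM. intros x y Hx Hy Hne. split; [|apply Nat.mod_upper_bound; lia].
    destruct (le_lt_dec y x).
    - replace (x + (2 ^ w - y)) with (x - y + 1 * 2 ^ w) by lia.
      rewrite Nat.Div0.mod_add, Nat.mod_small; lia.
    - rewrite Nat.mod_small; lia. }
  pose proof (window_count w sh _ Hw Hsh (Hdiff x y Hx Hy Hne)) as H1.
  pose proof (window_count w sh _ Hw Hsh (Hdiff y x Hy Hx (not_eq_sym Hne))) as H2.
  revert H1 H2. set (dxy := _ mod _). set (dyx := (y + _) mod _). intros H1 H2.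
  assert (Hc : length (filter (fun a => hash w a sh x =? hash w a sh y) (odds w)) <=
    length (filter (fun a => a * dxy mod 2 ^ w <? 2 ^ sh) (odds w)) +
    length (filter (fun a => a * dyx mod 2 ^ w <? 2 ^ sh) (odds w))).
  { rewrite !length_filter_sum, <- list_sum_map_add.
    apply list_sum_map_le. intros a _.
    destruct (Nat.eqb_spec (hash w a sh x) (hash w a sh y)) as [E|]; [|simpl; lia].
    destruct (le_lt_dec (a * y mod 2 ^ w) (a * x mod 2 ^ w)) as [Hle|Hlt].
    - pose proof (collision_window w a sh x y Hx Hy E Hle) as Hc.
      fold dxy in Hc. apply Nat.ltb_lt in Hc. rewrite Hc. simpl; lia.
    - pose proof (collision_window w a sh y x Hy Hx (eq_sym E) (Nat.lt_le_incl _ _ Hlt)) as Hc.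
      fold dyx in Hc. apply Nat.ltb_lt in Hc. rewrite Hc. simpl; lia. }
  nia.
Qed.

Definition collides (w a sh x y : nat) : bool :=
  negb (if Nat.eq_dec x y then true else false) && (hash w a sh y =? hash w a sh x).

Definition collisions (w a sh : nat) (keys : list nat) : nat :=
  list_sum (map (fun x => length (filter (collides w a sh x) keys)) keys).

(** The bound for one pair is summed over all ordered pairs; exchanging the sums bounds the average
    over odd multipliers, and some multiplier does not exceed the average. *)
Lemma few_collisions w sh keys :
  1 <= w -> sh <= w -> Forall (fun x => x < 2 ^ w) keys ->
  exists a, a < 2 ^ w /\
    2 ^ (w - sh) * collisions w a sh keys <= 2 * (length keys * length keys).
Proof.
  intros Hw Hsh Hk. rewrite Forall_forall in Hk.
  destruct (exists_le_average (fun a => 2 ^ (w - sh) * collisions w a sh keys)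
              (2 * (length keys * length keys)) (odds w)) as (a & Ha & Hle).
  - intros E. pose proof (odds_length w) as HL. rewrite E in HL.
    pose proof (pow2_pos (w - 1)). simpl in HL. lia.
  - rewrite list_sum_map_mul. unfold collisions.
    rewrite list_sum_swap, <- list_sum_map_mul, odds_length.
    replace (2 * (length keys * length keys) * 2 ^ (w - 1))
      with (length keys * (2 * 2 ^ (w - 1)) * length keys) by ring.
    rewrite <- list_sum_map_const. apply list_sum_map_le. intros x Hx.
    rewrite (list_sum_map_ext _
      (fun a => list_sum (map (fun y => Nat.b2n (collides w a sh x y)) keys)))
      by (intros; apply length_filter_sum).
    rewrite list_sum_swap, <- list_sum_map_mul, Nat.mul_comm, <- list_sum_map_const.
    apply list_sum_map_le. intros y Hy.
    rewrite <- length_filter_sum.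
    unfold collides. destruct (Nat.eq_dec x y) as [->|Hne]; simpl.
    + replace (length _) with 0; [lia|].
      symmetry. apply length_zero_iff_nil. induction (odds w); easy.
    + apply collision_count; auto.
  - exists a. apply in_odds in Ha; tauto.
Qed.

(** This turns the quadratic cost of the second-level tables into the collision count of the first
    level; pairs are ordered, so a bucket of n keys contributes n (n - 1). *)
Lemma collisions_by_bucket w a sh keys :
  sh <= w -> NoDup keys ->
  list_sum (map (fun i => let n := length (filter (fun x => hash w a sh x =? i) keys)
                          in n * (n - 1)) (seq 0 (2 ^ (w - sh)))) =
  collisions w a sh keys.
Proof.
  intros Hsh Hnd. cbv zeta.
  rewrite (list_sum_by_class (hash w a sh)
    (fun i => length (filter (fun x => hash w a sh x =? i) keys) - 1)).
  - apply list_sum_map_ext. intros x Hx.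
    rewrite (length_filter_remove Nat.eq_dec (fun y => hash w a sh y =? hash w a sh x)
      keys x Hnd Hx (Nat.eqb_refl _)).
    unfold collides. lia.
  - intros; now apply hash_lt.
Qed.

Lemma no_collision_injective w a sh keys x y :
  collisions w a sh keys = 0 -> In x keys -> In y keys ->
  hash w a sh x = hash w a sh y -> x = y.
Proof.
  intros H Hx Hy Hh.
  pose proof (list_sum_zero _ _ x H Hx) as H0; simpl in H0.
  apply length_zero_iff_nil in H0.
  destruct (Nat.eq_dec x y) as [|Hne]; [easy|exfalso].
  assert (Hin : In y (filter (collides w a sh x) keys)).
  { apply filter_In. split; [easy|]. unfold collides.
    destruct (Nat.eq_dec x y); [easy|]. simpl. now apply Nat.eqb_eq. }
  now rewrite H0 in Hin.
Qed.

Lemma hash_identity w x : x < 2 ^ w -> hash w 1 0 x = x.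
Proof. intros H. unfold hash. rewrite Nat.mul_1_l, Nat.mod_small, Nat.div_1_r; easy. Qed.

Lemma collisions_identity w keys :
  NoDup keys -> Forall (fun x => x < 2 ^ w) keys -> collisions w 1 0 keys = 0.
Proof.
  intros Hnd Hk. rewrite Forall_forall in Hk. unfold collisions.
  rewrite (list_sum_map_ext _ (fun _ => 0)).
  - rewrite list_sum_map_const. lia.
  - intros x Hx. apply length_zero_iff_nil.
    destruct (filter _ _) as [|y l] eqn:E; [easy|exfalso].
    assert (Hy : In y (y :: l)) by (left; easy). rewrite <- E in Hy.
    apply filter_In in Hy as [Hy Hc]. unfold collides in Hc.
    rewrite !hash_identity in Hc by auto.
    destruct (Nat.eq_dec x y); simpl in Hc; [easy|].
    apply Nat.eqb_eq in Hc. congruence.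
Qed.

(** With a range above 2 n^2 the bound on collisions drops below 1, so some multiplier has none. The
    range is at most 4 n^2 <= 8 n (n - 1) for n >= 2; the summand 1 covers smaller sets. *)
Lemma injective_hash w keys :
  1 <= w -> NoDup keys -> Forall (fun x => x < 2 ^ w) keys ->
  exists a sh, a < 2 ^ w /\ sh <= w /\
    2 ^ (w - sh) <= 1 + 8 * (length keys * (length keys - 1)) /\
    (forall x y, In x keys -> In y keys -> hash w a sh x = hash w a sh y -> x = y).
Proof.
  intros Hw Hnd Hk. set (n := length keys).
  assert (H2w : 2 <= 2 ^ w) by (change 2 with (2 ^ 1) at 1; apply Nat.pow_le_mono_r; lia).
  destruct (le_lt_dec n 1) as [Hn|Hn].
  - exists 0, w. rewrite Nat.sub_diag. repeat split; [lia|lia|simpl; lia|].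
    intros x y Hx Hy _. subst n. destruct keys as [|z [|z' l]]; simpl in *; [easy| |lia].
    intuition congruence.
  - pose proof (Nat.log2_spec (2 * (n * n)) ltac:(nia)) as [Hlo Hhi].
    set (m := S (Nat.log2 (2 * (n * n)))) in *.
    assert (Hm : 2 ^ m <= 4 * (n * n)) by (subst m; rewrite Nat.pow_succ_r'; lia).
    destruct (le_lt_dec m w) as [Hmw|Hmw].
    + destruct (few_collisions w (w - m) keys Hw ltac:(lia) Hk) as (a & Ha & Hc).
      exists a, (w - m). replace (w - (w - m)) with m in * by lia.
      repeat split; [easy|lia|nia|].
      intros x y. apply no_collision_injective. fold n in Hc. nia.
    (* The desired range exceeds 2^w, so the identity, with range 2^w, is within the bound. *)
    + exists 1, 0. rewrite Nat.sub_0_r.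
      assert (2 ^ w <= 2 ^ m) by (apply Nat.pow_le_mono_r; lia).
      repeat split; [lia|lia|nia|].
      intros x y. apply no_collision_injective. now apply collisions_identity.
Qed.

(** For a range between n and 2 n there are at most 2 n collisions, and 2 n + 8 * 2 n = 18 n. The
    sum being bounded dominates the total length of the second-level tables. *)
Lemma first_level_hash w keys :
  1 <= w -> NoDup keys -> Forall (fun x => x < 2 ^ w) keys -> keys <> [] ->
  exists a sh, a < 2 ^ w /\ sh <= w /\
    2 ^ (w - sh) + 8 * collisions w a sh keys <= 2 ^ w /\
    2 ^ (w - sh) + 8 * collisions w a sh keys <= 18 * length keys.
Proof.
  intros Hw Hnd Hk Hne. set (n := length keys).
  assert (Hn : 0 < n) by (destruct keys; [easy|subst n; simpl; lia]).
  assert (H2w : 2 <= 2 ^ w) by (change 2 with (2 ^ 1) at 1; apply Nat.pow_le_mono_r; lia).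
  destruct (le_lt_dec (18 * n) (2 ^ w)) as [Hbig|Hsmall].
  - pose proof (Nat.log2_spec n Hn) as [Hlo Hhi].
    set (m := S (Nat.log2 n)) in *.
    assert (Hm : 2 ^ m <= 2 * n) by (subst m; rewrite Nat.pow_succ_r'; lia).
    assert (Hmw : m < w) by (apply (Nat.pow_lt_mono_r_iff 2); lia).
    destruct (few_collisions w (w - m) keys Hw ltac:(lia) Hk) as (a & Ha & Hc).
    exists a, (w - m). replace (w - (w - m)) with m in * by lia. fold n in Hc.
    assert (collisions w a (w - m) keys <= 2 * n) by nia.
    repeat split; [easy|lia|lia|lia].
  - exists 1, 0. rewrite (collisions_identity w keys Hnd Hk), Nat.sub_0_r.
    repeat split; lia.
Qed.

(** * Perfect hashing *)

(** The two-level scheme of Fredman, Komlos and Szemeredi: bucket [i] owns a table that begins at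
    [o i] and has its own multiplier and shift. *)
Definition slot (w a1 sh1 : nat) (a o sh : nat -> nat) (x : nat) : nat :=
  let i := hash w a1 sh1 x in o i + hash w (a i) (sh i) x.

Lemma list_sum_seq_step f n : list_sum (map f (seq 0 (S n))) = list_sum (map f (seq 0 n)) + f n.
Proof. rewrite seq_S, map_app, list_sum_app. simpl. lia. Qed.

Lemma list_sum_seq_le f m n :
  m <= n -> list_sum (map f (seq 0 m)) <= list_sum (map f (seq 0 n)).
Proof.
  induction 1 as [|n _ IH]; [easy|]. rewrite list_sum_seq_step. lia.
Qed.

(* Two-level hashing; in the case 2^w < 18 * length keys the first level is the
   identity, which keeps all slots addressable by one word. *)
Lemma perfect_hash w keys :
  1 <= w -> NoDup keys -> Forall (fun x => x < 2 ^ w) keys -> keys <> [] ->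
  exists a1 sh1 (a o sh : nat -> nat) T,
    a1 < 2 ^ w /\ sh1 <= w /\
    2 ^ (w - sh1) <= 18 * length keys /\ T <= 18 * length keys /\ T <= 2 ^ w /\
    (forall i, i < 2 ^ (w - sh1) ->
       a i < 2 ^ w /\ sh i <= w /\ o i + 2 ^ (w - sh i) <= T) /\
    (forall x y, In x keys -> In y keys ->
       slot w a1 sh1 a o sh x = slot w a1 sh1 a o sh y -> x = y).
Proof.
  intros Hw Hnd Hk Hne.
  destruct (first_level_hash w keys Hw Hnd Hk Hne) as (a1 & sh1 & Ha1 & Hsh1 & HTw & HTn).
  set (bucket := fun i => filter (fun x => hash w a1 sh1 x =? i) keys).
  destruct (finite_choice (0, 0) (fun i p => fst p < 2 ^ w /\ snd p <= w /\
      2 ^ (w - snd p) <= 1 + 8 * (length (bucket i) * (length (bucket i) - 1)) /\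
      (forall x y, In x (bucket i) -> In y (bucket i) ->
         hash w (fst p) (snd p) x = hash w (fst p) (snd p) y -> x = y))
      (2 ^ (w - sh1))) as (f & Hf).
  { intros i _. destruct (injective_hash w (bucket i)) as (a & sh & H); [easy| | |].
    - now apply NoDup_filter.
    - rewrite Forall_forall in *. intros x [Hx _]%filter_In. auto.
    - exists (a, sh). exact H. }
  set (sz := fun i => 2 ^ (w - snd (f i))).
  set (o := fun i => list_sum (map sz (seq 0 i))).
  assert (HT : o (2 ^ (w - sh1)) <= 2 ^ (w - sh1) + 8 * collisions w a1 sh1 keys).
  { rewrite <- (collisions_by_bucket w a1 sh1 keys Hsh1 Hnd).
    subst o; cbv beta zeta.
    transitivity (list_sum (map (fun i => 1 + 8 * (length (bucket i) * (length (bucket i) - 1)))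
      (seq 0 (2 ^ (w - sh1))))).
    - apply list_sum_map_le. intros i Hi%in_seq. apply Hf. lia.
    - rewrite list_sum_map_add, list_sum_map_const, list_sum_map_mul, length_seq.
      subst bucket; cbv beta. lia. }
  assert (Hstep : forall i j, i < j -> o i + sz i <= o j).
  { intros i j Hij. subst o; cbv beta. rewrite <- list_sum_seq_step.
    now apply list_sum_seq_le. }
  exists a1, sh1, (fun i => fst (f i)), o, (fun i => snd (f i)), (o (2 ^ (w - sh1))).
  repeat split; try easy; try lia; try (now apply Hf).
  - now apply Hstep.
  - intros x y Hx Hy Heq. unfold slot in Heq; cbv zeta in Heq.
    pose proof (hash_lt w a1 sh1 x Hsh1) as Hbx. pose proof (hash_lt w a1 sh1 y Hsh1) as Hby.
    set (i := hash w a1 sh1 x) in *. set (j := hash w a1 sh1 y) in *.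
    destruct (Hf i Hbx) as (_ & Hshi & _ & Hinj). destruct (Hf j Hby) as (_ & Hshj & _ & _).
    pose proof (hash_lt w (fst (f i)) (snd (f i)) x Hshi) as Hhx.
    pose proof (hash_lt w (fst (f j)) (snd (f j)) y Hshj) as Hhy.
    assert (E : i = j).
    { destruct (Nat.lt_trichotomy i j) as [H|[H|H]]; [|easy|];
        apply Hstep in H; subst sz; cbv beta in H; lia. }
    rewrite <- E in Heq. apply Hinj.
    + apply filter_In. split; [easy|]. now apply Nat.eqb_eq.
    + apply filter_In. split; [easy|]. now apply Nat.eqb_eq.
    + lia.
Qed.

(** * The query program *)

(* Registers: 0 current position, 1 width of the level examined, 2 and 3 factor
   and divisor changing the level, 4 loop flag, 10-16 constants stored in
   arrays 0-6, 17 one, 18 zero, from 20 on scratch. *)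

Fixpoint seqs (l : list prog) (p : prog) : prog :=
  match l with
  | [] => p
  | x :: l' => Seq x (seqs l' p)
  end.

(** Register 18 is never assigned: it indexes the one-word arrays, and adding it copies a register.
    The search starts upwards from width 1, that is, level 0. *)
Definition init : list prog :=
  [Fetch 10 0 18; Fetch 11 1 18; Fetch 12 2 18; Fetch 13 3 18;
   Fetch 14 4 18; Fetch 15 5 18; Fetch 16 6 18;
   Const 17 1; Op 1 Add 17 18; Op 2 Add 10 18; Op 3 Add 17 18; Op 4 Add 17 18].

(** One unsigned comparison tests both ends of a phrase, since a position before its start wraps
    around. Array 13 holds lengths minus 1 because a length can be 2^w. *)
Definition check : list prog :=
  [Fetch 33 12 32; Fetch 34 13 32; Op 35 Sub 0 33; Op 36 Less 34 35].

(** A failed check replaces the candidate index by its predecessor, if there is one. This is done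
    arithmetically, without a branch: after a hit the second check repeats the first. *)
Definition probe : list prog :=
  [Op 20 Div 0 1; Op 21 Div 20 10; Op 22 Mod 20 10;
   Op 23 Mul 21 10; Op 23 Add 23 17; Op 23 Mul 23 1;
   Op 24 Mul 12 23; Op 24 Shr 24 13;
   Fetch 25 7 24; Fetch 26 8 24; Fetch 27 9 24;
   Op 28 Mul 25 23; Op 28 Shr 28 27; Op 28 Add 26 28;
   Fetch 29 10 28; Fetch 30 11 28;
   Op 31 Mul 11 22; Op 30 Shr 30 31; Op 30 Mod 30 10; Op 32 Add 29 30] ++
  check ++
  [Op 37 Less 18 32; Op 37 Mul 37 36; Op 32 Sub 32 37] ++
  check.

(** One code for both directions: factor B and divisor 1 ascend, factor 1 and divisor B descend. *)
Definition change_level : prog := Seq (Op 1 Mul 1 2) (Seq (Op 1 Div 1 3) Skip).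

(** Every jump sets the direction to descending, so only the first search ascends. The kind becomes
    the loop flag, so the loop ends with the jump out of an explicit phrase. *)
Definition jump : prog :=
  seqs [Fetch 38 14 32; Op 0 Add 38 35; Fetch 1 15 32; Fetch 4 16 32;
        Op 2 Add 17 18; Op 3 Add 10 18] Skip.

Definition body : prog := seqs probe (If 36 change_level jump).

Definition extract : prog :=
  seqs [Op 20 Div 0 14; Fetch 21 17 20; Op 22 Mod 0 14; Op 22 Mul 15 22;
        Op 21 Shr 21 22; Op 0 And 21 16] Skip.

Definition query : prog := seqs init (Seq (While 4 body) extract).

(** * Bounded executions *)

Definition steps (w : nat) (M : memory) (p : prog) (rho : registers)
  (Q : registers -> Prop) (k : nat) : Prop :=
  exists rho' T, exec w M p rho rho' T /\ T <= k /\ Q rho'.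

Definition nat_op (w : nat) (o : binop) (x y : nat) : nat :=
  match o with
  | Add => (x + y) mod 2 ^ w
  | Sub => (x + 2 ^ w - y) mod 2 ^ w
  | Mul => x * y mod 2 ^ w
  | Div => x / y
  | Mod => x mod y
  | Shr => x / 2 ^ y
  | Less => Nat.b2n (x <? y)
  | _ => N.to_nat (eval_op w o (N.of_nat x) (N.of_nat y))
  end.

Lemma of_nat_pow2 k : N.of_nat (2 ^ k) = (2 ^ N.of_nat k)%N.
Proof. now rewrite Nat2N.inj_pow. Qed.

Lemma eval_op_nat w o x y :
  eval_op w o (N.of_nat x) (N.of_nat y) = N.of_nat (nat_op w o x y).
Proof.
  destruct o; try (symmetry; apply N2Nat.id); unfold eval_op, nat_op;
    rewrite ?N.shiftr_div_pow2, <- ?of_nat_pow2.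
  - now rewrite Nat2N.inj_mod, Nat2N.inj_add.
  - now rewrite Nat2N.inj_mod, Nat2N.inj_sub, Nat2N.inj_add.
  - now rewrite Nat2N.inj_mod, Nat2N.inj_mul.
  - now rewrite Nat2N.inj_div.
  - now rewrite Nat2N.inj_mod.
  - now rewrite Nat2N.inj_div.
  - destruct (N.ltb_spec (N.of_nat x) (N.of_nat y)), (Nat.ltb_spec x y); simpl; lia.
Qed.

Lemma nat_op_and_mask w x b : nat_op w And x (2 ^ b - 1) = x mod 2 ^ b.
Proof.
  unfold nat_op, eval_op. rewrite Nat2N.inj_sub, of_nat_pow2.
  replace (2 ^ N.of_nat b - N.of_nat 1)%N with (N.ones (N.of_nat b))
    by (rewrite N.ones_equiv; lia).
  rewrite N.land_ones, <- of_nat_pow2, <- Nat2N.inj_mod. apply Nat2N.id.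
Qed.

Section Steps.

Variables (w : nat) (M : memory).

Lemma steps_skip rho (Q : registers -> Prop) : Q rho -> steps w M Skip rho Q 0.
Proof. intros H. exists rho, 0. repeat split; [constructor|lia|easy]. Qed.

Lemma steps_weaken p rho (Q Q' : registers -> Prop) k k' :
  steps w M p rho Q k -> k <= k' -> (forall rho', Q rho' -> Q' rho') ->
  steps w M p rho Q' k'.
Proof. intros (rho' & T & H & HT & HQ) Hk HQ'. exists rho', T. repeat split; [easy|lia|auto]. Qed.

Lemma steps_seq p1 p2 rho Q k1 k2 :
  steps w M p1 rho (fun rho' => steps w M p2 rho' Q k2) k1 ->
  steps w M (Seq p1 p2) rho Q (k1 + k2).
Proof.
  intros (rho1 & T1 & H1 & HT1 & rho2 & T2 & H2 & HT2 & HQ).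
  exists rho2, (T1 + T2). repeat split; [econstructor; eassumption|lia|easy].
Qed.

Lemma steps_op d o x y p rho Q k vx vy v :
  rho x = N.of_nat vx -> rho y = N.of_nat vy -> nat_op w o vx vy = v ->
  steps w M p (set_reg rho d (N.of_nat v)) Q k ->
  steps w M (Seq (Op d o x y) p) rho Q (S k).
Proof.
  intros Hx Hy <- H. apply (steps_seq _ _ _ _ 1 k).
  eexists _, _. split; [constructor|]. split; [lia|].
  now rewrite Hx, Hy, eval_op_nat.
Qed.

Lemma steps_const d v p rho Q k :
  v < 2 ^ w ->
  steps w M p (set_reg rho d (N.of_nat v)) Q k ->
  steps w M (Seq (Const d (N.of_nat v)) p) rho Q (S k).
Proof.
  intros Hv H. apply (steps_seq _ _ _ _ 1 k).
  eexists _, _. split; [constructor|]. split; [lia|].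
  now rewrite <- of_nat_pow2, <- Nat2N.inj_mod, Nat.mod_small.
Qed.

Lemma steps_fetch d arr a p rho Q k va v :
  rho a = N.of_nat va -> nth_error (nth arr M []) va = Some (N.of_nat v) ->
  steps w M p (set_reg rho d (N.of_nat v)) Q k ->
  steps w M (Seq (Fetch d arr a) p) rho Q (S k).
Proof.
  intros Ha Hv H. apply (steps_seq _ _ _ _ 1 k).
  eexists _, _. split; [|split; [|eassumption]].
  - constructor. unfold read. now rewrite Ha, Nat2N.id.
  - lia.
Qed.

Lemma steps_if x p1 p2 rho Q k b :
  rho x = N.of_nat (Nat.b2n b) ->
  steps w M (if b then p1 else p2) rho Q k ->
  steps w M (If x p1 p2) rho Q (k + 1).
Proof.
  intros Hx (rho' & T & H & HT & HQ). exists rho', (T + 1).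
  repeat split; [|lia|easy].
  destruct b; [apply exec_if_true|apply exec_if_false]; rewrite ?Hx; easy.
Qed.

Lemma steps_while_stop x p rho (Q : registers -> Prop) :
  rho x = 0%N -> Q rho -> steps w M (While x p) rho Q 1.
Proof. intros Hx HQ. exists rho, 1. repeat split; [now constructor|lia|easy]. Qed.

Lemma steps_while x p rho Q k1 k2 :
  rho x = 1%N ->
  steps w M p rho (fun rho' => steps w M (While x p) rho' Q k2) k1 ->
  steps w M (While x p) rho Q (k1 + k2 + 1).
Proof.
  intros Hx (rho1 & T1 & H1 & HT1 & rho2 & T2 & H2 & HT2 & HQ).
  exists rho2, (T1 + T2 + 1). repeat split; [|lia|easy].
  eapply exec_while_true; [now rewrite Hx| |]; eassumption.
Qed.

End Steps.

Definition words (l : list nat) : list N := map N.of_nat l.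

Definition table (f : nat -> nat) (m : nat) : list nat := map f (seq 0 m).

Lemma nth_error_table f m i :
  i < m -> nth_error (words (table f m)) i = Some (N.of_nat (f i)).
Proof.
  intros H. unfold words, table. rewrite !nth_error_map, nth_error_seq.
  destruct (Nat.ltb_spec i m); [easy|lia].
Qed.

Lemma nth_error_words_map (f : nat -> nat) l i x :
  nth_error l i = Some x -> nth_error (words (map f l)) i = Some (N.of_nat (f x)).
Proof. intros H. unfold words. now rewrite !nth_error_map, H. Qed.

(** * Packed words *)

Fixpoint pack (b : nat) (f : nat -> nat) (m : nat) : nat :=
  match m with
  | 0 => 0
  | S m' => pack b f m' + f m' * 2 ^ (b * m')
  end.

Lemma pack_lt b f m :
  (forall i, i < m -> f i < 2 ^ b) -> pack b f m < 2 ^ (b * m).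
Proof.
  induction m as [|m IH]; simpl pack; intros H.
  - rewrite Nat.mul_0_r. simpl. lia.
  - rewrite Nat.mul_succ_r, Nat.pow_add_r.
    specialize (IH (fun i Hi => H i (Nat.lt_lt_succ_r _ _ Hi))).
    specialize (H m (Nat.lt_succ_diag_r m)). nia.
Qed.

Lemma unpack b f m i :
  (forall i, i < m -> f i < 2 ^ b) -> i < m ->
  pack b f m / 2 ^ (b * i) mod 2 ^ b = f i.
Proof.
  induction m as [|m IH]; intros H Hi; [lia|]. simpl pack.
  pose proof (pow2_pos b) as Hb. pose proof (pow2_pos (b * i)) as Hbi.
  assert (Hlow : pack b f m < 2 ^ (b * m)) by (apply pack_lt; auto).
  destruct (Nat.eq_dec i m) as [->|Hne].
  - rewrite Nat.div_add, (Nat.div_small (pack b f m)) by lia. simpl.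
    apply Nat.mod_small. auto.
  - replace (2 ^ (b * m)) with (2 ^ (b * (m - i - 1)) * 2 ^ b * 2 ^ (b * i))
      by (rewrite <- !Nat.pow_add_r; f_equal; nia).
    rewrite !Nat.mul_assoc, Nat.div_add, Nat.Div0.mod_add by lia.
    apply IH; [auto|lia].
Qed.

(** * Phrases sorted by level *)

Lemma filter_none {A} (p : A -> bool) l :
  (forall x, In x l -> p x = false) -> filter p l = [].
Proof.
  induction l as [|x l IH]; simpl; intros H; [easy|].
  rewrite (H x) by auto. apply IH. auto.
Qed.

Lemma length_filter_le_one {A} (p : A -> bool) l :
  NoDup l -> (forall x y, In x l -> In y l -> p x = true -> p y = true -> x = y) ->
  length (filter p l) <= 1.
Proof.
  intros Hnd H. apply (NoDup_filter p) in Hnd.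
  destruct (filter p l) as [|x [|y l']] eqn:E; simpl; [lia|lia|exfalso].
  inversion Hnd as [|? ? Hx _]; subst.
  assert (Hin : In x (filter p l) /\ In y (filter p l)) by (rewrite E; simpl; auto).
  destruct Hin as [Hx'%filter_In Hy'%filter_In].
  apply Hx. left. symmetry. apply H; tauto.
Qed.

Section Phrases.

Variables (w n t beta : nat) (st : nat -> nat).
Hypothesis n_le : n <= 2 ^ w.
Hypothesis t_pos : 1 <= t.
Hypothesis st_first : st 1 = 0.
Hypothesis st_last : st (t + 1) = n.
Hypothesis st_step : forall i, 1 <= i <= t -> st i < st (i + 1).
Hypothesis beta_pos : 1 <= beta.
Hypothesis beta_le : 2 ^ beta * beta <= w.

Definition len (i : nat) : nat := st (i + 1) - st i.

(** Taking [len i - 1] keeps the width of the level below 2^w even for a phrase of length 2^w; the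
    maximum caters for phrases of length 1. *)
Definition level (i : nat) : nat := Nat.log2 (max 1 (len i - 1)) / beta.

Definition width (k : nat) : nat := 2 ^ (beta * k).

Definition contains (i r : nat) : Prop := 1 <= i <= t /\ st i <= r < st (i + 1).

Lemma st_next i j : 1 <= i -> i < j <= t + 1 -> st (i + 1) <= st j.
Proof.
  intros Hi [Hij Hj]. induction j as [|j IH]; [lia|].
  destruct (Nat.eq_dec i j) as [->|Hne]; [rewrite Nat.add_1_r; lia|].
  specialize (IH ltac:(lia) ltac:(lia)).
  pose proof (st_step j ltac:(lia)). rewrite Nat.add_1_r in H. lia.
Qed.

Lemma contains_lt i r : contains i r -> r < n.
Proof.
  intros [Hi Hr]. rewrite <- st_last.
  pose proof (st_next i (t + 1) ltac:(lia) ltac:(lia)). lia.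
Qed.

Lemma contains_unique i j r : contains i r -> contains j r -> i = j.
Proof.
  intros [Hi Hir] [Hj Hjr].
  destruct (Nat.lt_trichotomy i j) as [H|[H|H]]; [|easy|].
  - pose proof (st_next i j ltac:(lia) ltac:(lia)). lia.
  - pose proof (st_next j i ltac:(lia) ltac:(lia)). lia.
Qed.

Lemma contains_exists r : r < n -> exists i, contains i r.
Proof.
  rewrite <- st_last. enough (H : forall m, m <= t -> r < st (m + 1) ->
    exists i, 1 <= i <= t /\ st i <= r < st (i + 1)) by (apply H; lia).
  induction m as [|m IH]; intros Hm Hr; [simpl in Hr; lia|].
  destruct (le_lt_dec (st (S m)) r) as [Hle|Hlt].
  - exists (S m). lia.
  - apply IH; [lia|]. now rewrite Nat.add_1_r.
Qed.

Lemma len_pos i : 1 <= i <= t -> 1 <= len i.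
Proof. intros H. apply st_step in H. unfold len. lia. Qed.

Lemma st_len i : 1 <= i <= t -> st (i + 1) = st i + len i.
Proof. intros H. apply st_step in H. unfold len. lia. Qed.

Lemma count_le_n : t <= n.
Proof.
  rewrite <- st_last. clear - st_step.
  enough (H : forall m, m <= t -> m <= st (m + 1)) by now apply H.
  induction m as [|m IH]; intros Hm; [lia|].
  pose proof (st_step (S m) ltac:(lia)). rewrite Nat.add_1_r in *.
  specialize (IH ltac:(lia)). lia.
Qed.

Lemma width_pos k : 0 < width k.
Proof. apply pow2_pos. Qed.

Lemma width_succ k : width (S k) = width k * 2 ^ beta.
Proof. unfold width. rewrite Nat.mul_succ_r, Nat.pow_add_r. easy. Qed.

Lemma width_level_le i : width (level i) <= max 1 (len i - 1).
Proof.
  unfold width, level. set (x := max 1 (len i - 1)).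
  transitivity (2 ^ Nat.log2 x).
  - apply Nat.pow_le_mono_r; [lia|]. apply Nat.Div0.mul_div_le.
  - apply Nat.log2_spec. lia.
Qed.

(** Rounding the logarithm down puts [len i - 1] strictly below the next width. Hence a phrase is no
    longer than one block of its level. *)
Lemma len_le_width i : len i <= width (level i + 1).
Proof.
  unfold width, level. set (x := max 1 (len i - 1)).
  assert (Hx : x < 2 ^ (beta * (Nat.log2 x / beta + 1))).
  { apply Nat.lt_le_trans with (2 ^ S (Nat.log2 x)).
    - apply Nat.log2_spec. lia.
    - apply Nat.pow_le_mono_r; [lia|].
      pose proof (Nat.mul_succ_div_gt (Nat.log2 x) beta). lia. }
  lia.
Qed.

Lemma w_pos : 2 <= w.
Proof.
  assert (2 ^ 1 <= 2 ^ beta) by (apply Nat.pow_le_mono_r; lia). simpl in H. nia.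
Qed.

Lemma level_bound i : 1 <= i <= t -> beta * level i < w.
Proof.
  intros Hi. apply (Nat.pow_lt_mono_r_iff 2); [lia|].
  apply Nat.le_lt_trans with (max 1 (len i - 1)); [apply width_level_le|].
  assert (2 ^ 2 <= 2 ^ w) by (apply Nat.pow_le_mono_r; [lia|apply w_pos]).
  pose proof (st_len i Hi). pose proof (st_next i (t + 1) ltac:(lia) ltac:(lia)).
  simpl in H. lia.
Qed.

Lemma width_level_le_len i : 1 <= i <= t -> width (level i) <= len i.
Proof.
  intros Hi. pose proof (width_level_le i). pose proof (len_pos i Hi). lia.
Qed.

(** Phrases of one level are contiguous and sorted by position, so a count of starts within the
    level becomes an index once the number of phrases of lower levels is added. *)
Definition order : list nat :=
  flat_map (fun k => filter (fun i => level i =? k) (seq 1 t)) (seq 0 w).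

Lemma length_levels l m :
  length (flat_map (fun k => filter (fun i => level i =? k) l) (seq 0 m)) =
  length (filter (fun i => level i <? m) l).
Proof.
  induction m as [|m IH].
  - simpl. now rewrite filter_none.
  - rewrite seq_S, flat_map_app, length_app, IH. simpl. rewrite app_nil_r, !length_filter_sum.
    rewrite <- list_sum_map_add. apply list_sum_map_ext. intros i _.
    destruct (Nat.ltb_spec (level i) m), (Nat.eqb_spec (level i) m),
      (Nat.ltb_spec (level i) (S m)); simpl; lia.
Qed.

Lemma length_order_le : length order <= t.
Proof.
  unfold order. rewrite length_levels.
  rewrite <- (length_seq t 1) at 2. apply filter_length_le.
Qed.

Lemma in_order i : In i order -> 1 <= i <= t.
Proof.
  unfold order. rewrite in_flat_map. intros (k & _ & [Hi%in_seq _]%filter_In). lia.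
Qed.

Definition before (k s : nat) : nat :=
  length (filter (fun i => level i <? k) (seq 1 t)) +
  length (filter (fun i => (level i =? k) && (st i / width k <? s)) (seq 1 t)).

(** The cap keeps every index inside [order], as a fetch outside an array would block the
    machine. *)
Definition rank (k s : nat) : nat := min (before k s) (length order - 1).

Lemma level_lt_w i : 1 <= i <= t -> level i < w.
Proof. intros Hi. pose proof (level_bound i Hi). nia. Qed.

Lemma seq_split i : 1 <= i <= t -> seq 1 t = seq 1 (i - 1) ++ i :: seq (i + 1) (t - i).
Proof.
  intros Hi.
  assert (E : t = (i - 1) + S (t - i)) by lia. rewrite E at 1.
  rewrite seq_app. replace (1 + (i - 1)) with i by lia.
  simpl. now rewrite Nat.add_1_r.
Qed.

Definition order_index (i : nat) : nat :=
  length (filter (fun j => level j <? level i) (seq 1 t)) +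
  length (filter (fun j => level j =? level i) (seq 1 (i - 1))).

Lemma nth_error_order i : 1 <= i <= t -> nth_error order (order_index i) = Some i.
Proof.
  intros Hi. pose proof (level_lt_w i Hi) as Hl.
  unfold order, order_index. rewrite <- length_levels.
  replace w with (level i + S (w - level i - 1)) at 1 by lia.
  rewrite seq_app, flat_map_app. simpl.
  assert (E : filter (fun j => level j =? level i) (seq 1 t) =
    filter (fun j => level j =? level i) (seq 1 (i - 1)) ++
    i :: filter (fun j => level j =? level i) (seq (i + 1) (t - i))).
  { rewrite (seq_split i Hi), filter_app. simpl. now rewrite Nat.eqb_refl. }
  rewrite E, <- !app_assoc.
  rewrite nth_error_app2, (Nat.add_comm (length (flat_map _ _))), Nat.add_sub by lia.
  rewrite nth_error_app2, Nat.sub_diag by lia. easy.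
Qed.

Lemma order_index_lt i : 1 <= i <= t -> order_index i < length order.
Proof.
  intros Hi. apply nth_error_Some. now rewrite nth_error_order.
Qed.

(** Each earlier phrase of the level is at least one cell long, so it starts in a cell before that
    of [r]; no later phrase does. Only phrase [i] is in doubt: it is counted unless it starts in the
    cell of [r]. *)
Lemma before_index i r :
  contains i r ->
  before (level i) (r / width (level i)) = order_index i \/
  before (level i) (r / width (level i)) = order_index i + 1.
Proof.
  intros [Hi Hr]. unfold before, order_index.
  set (k := level i). pose proof (width_pos k) as Hw.
  assert (E : length (filter (fun j => (level j =? k) && (st j / width k <? r / width k)) (seq 1 t)) =
    length (filter (fun j => level j =? k) (seq 1 (i - 1))) +
    Nat.b2n ((level i =? k) && (st i / width k <? r / width k))).
  { rewrite (seq_split i Hi), filter_app, length_app. f_equal.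
    - f_equal. apply filter_ext_in. intros j Hj%in_seq.
      destruct (Nat.eqb_spec (level j) k) as [E|]; [simpl|easy].
      apply Nat.ltb_lt.
      pose proof (width_level_le_len j ltac:(lia)) as Hwl. rewrite E in Hwl.
      pose proof (st_next j i ltac:(lia) ltac:(lia)) as Hn.
      rewrite st_len in Hn by lia.
      apply Nat.lt_le_trans with ((st j + 1 * width k) / width k).
      + rewrite Nat.div_add by lia. lia.
      + apply Nat.Div0.div_le_mono. lia.
    - simpl. rewrite (filter_none _ (seq (i + 1) (t - i))).
      + destruct (_ && _); easy.
      + intros j Hj%in_seq. apply andb_false_iff. right. apply Nat.ltb_ge.
        apply Nat.Div0.div_le_mono.
        pose proof (st_next i j ltac:(lia) ltac:(lia)). lia. }
  rewrite E. destruct (_ && _); simpl; lia.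
Qed.

Lemma rank_correct i r :
  contains i r ->
  let c := rank (level i) (r / width (level i)) in
  nth_error order c = Some i \/ (0 < c /\ nth_error order (c - 1) = Some i).
Proof.
  intros H c. pose proof (order_index_lt i (proj1 H)) as Hlt.
  (* The cap can only lower [order_index i + 1] to [order_index i], again one of the two
     candidates. *)
  assert (E : c = order_index i \/ c = order_index i + 1).
  { subst c. unfold rank. destruct (before_index i r H) as [-> | ->]; lia. }
  destruct E as [-> | ->].
  - left. apply nth_error_order, H.
  - right. split; [lia|]. rewrite Nat.add_sub. apply nth_error_order, H.
Qed.

Lemma start_cell_unique i j k :
  1 <= i <= t -> 1 <= j <= t -> level i = k -> level j = k ->
  st i / width k = st j / width k -> i = j.
Proof.
  assert (Hlt : forall i j, 1 <= i <= t -> 1 <= j <= t -> level i = k -> i < j ->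
            st i / width k < st j / width k).
  { intros i' j' Hi Hj Ei Hij. pose proof (width_pos k).
    pose proof (width_level_le_len i' Hi). rewrite Ei in *.
    pose proof (st_next i' j' ltac:(lia) ltac:(lia)). rewrite st_len in * by easy.
    apply Nat.lt_le_trans with ((st i' + 1 * width k) / width k).
    - rewrite Nat.div_add by lia. lia.
    - apply Nat.Div0.div_le_mono. lia. }
  intros Hi Hj Ei Ej E.
  destruct (Nat.lt_trichotomy i j) as [H|[H|H]]; [|easy|];
    apply Hlt in H; auto; lia.
Qed.

Lemma before_step k s : before k s <= before k (S s) <= before k s + 1.
Proof.
  unfold before.
  assert (E : length (filter (fun i => (level i =? k) && (st i / width k <? S s)) (seq 1 t)) =
    length (filter (fun i => (level i =? k) && (st i / width k <? s)) (seq 1 t)) +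
    length (filter (fun i => (level i =? k) && (st i / width k =? s)) (seq 1 t))).
  { rewrite !length_filter_sum, <- list_sum_map_add. apply list_sum_map_ext. intros i _.
    destruct (level i =? k), (Nat.ltb_spec (st i / width k) (S s)),
      (Nat.ltb_spec (st i / width k) s), (Nat.eqb_spec (st i / width k) s); simpl; lia. }
  rewrite E.
  assert (length (filter (fun i => (level i =? k) && (st i / width k =? s)) (seq 1 t)) <= 1).
  { apply length_filter_le_one; [apply seq_NoDup|].
    intros i j Hi%in_seq Hj%in_seq [Ei Fi]%andb_prop [Ej Fj]%andb_prop.
    apply Nat.eqb_eq in Ei, Ej, Fi, Fj.
    apply (start_cell_unique i j k); lia. }
  lia.
Qed.

(** At most one phrase of the level starts in each cell. Within a block, ranks therefore exceed the
    first one by less than 2^beta, and [beta] bits hold the difference. *)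
Lemma rank_shift k s m : rank k s <= rank k (s + m) <= rank k s + m.
Proof.
  enough (before k s <= before k (s + m) <= before k s + m) by (unfold rank; lia).
  induction m as [|m IH]; [rewrite Nat.add_0_r; lia|].
  rewrite Nat.add_succ_r. pose proof (before_step k (s + m)). lia.
Qed.

Lemma order_nonempty : 0 < length order.
Proof. pose proof (order_index_lt 1 ltac:(lia)). lia. Qed.

Lemma rank_lt k s : rank k s < length order.
Proof. unfold rank. pose proof order_nonempty. lia. Qed.

(** * Blocks *)

(* A block of level [k] consists of [2^beta] cells of width [width k]; its key
   determines [k] because [b * 2^beta + 1] is not a multiple of [2^beta]. *)
Definition key (k b : nat) : nat := (b * 2 ^ beta + 1) * width k.

Lemma two_le_pow_beta : 2 <= 2 ^ beta.
Proof. change 2 with (2 ^ 1) at 1. apply Nat.pow_le_mono_r; lia. Qed.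

Lemma key_inj k b k' b' : key k b = key k' b' -> k = k' /\ b = b'.
Proof.
  pose proof two_le_pow_beta as HB.
  assert (Hlt : forall k b k' b', k < k' -> key k b <> key k' b').
  { clear k b k' b'. intros k b k' b' Hk E. unfold key in E.
    assert (Hk' : width k' = 2 ^ (beta * (k' - k - 1)) * 2 ^ beta * width k).
    { unfold width. rewrite <- !Nat.pow_add_r. f_equal. nia. }
    rewrite Hk', !Nat.mul_assoc in E. pose proof (width_pos k).
    apply Nat.mul_cancel_r in E as E'; [|lia].
    apply (f_equal (fun x => x mod 2 ^ beta)) in E'.
    cbv beta in E'. rewrite Nat.Div0.mod_mul, (Nat.add_comm (b * _)), Nat.Div0.mod_add, Nat.mod_small in E' by lia. lia. }
  intros E. destruct (Nat.lt_trichotomy k k') as [H|[->|H]].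
  - now apply (Hlt k b k' b') in H.
  - split; [easy|]. unfold key in E. pose proof (width_pos k').
    apply Nat.mul_cancel_r in E; [|lia].
    apply (Nat.mul_cancel_r _ _ (2 ^ beta)); lia.
  - symmetry in E. now apply (Hlt k' b' k b) in H.
Qed.

(** A matter of parity: 2^w is an even multiple of [width k], and the even number b * 2^beta is
    below that multiplier, so its successor is too. *)
Lemma key_lt k r : beta * k < w -> r < 2 ^ w -> key k (r / width k / 2 ^ beta) < 2 ^ w.
Proof.
  intros Hk Hr. unfold key. pose proof (width_pos k) as HD. pose proof (pow2_pos beta) as HB.
  set (X := 2 ^ (w - beta * k - 1)).
  assert (HX : 2 ^ w = 2 * X * width k).
  { unfold X, width. rewrite <- Nat.pow_succ_r', <- Nat.pow_add_r. f_equal. lia. }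
  set (b := r / width k / 2 ^ beta).
  assert (Hb : b * 2 ^ beta < 2 * X).
  { apply Nat.le_lt_trans with (r / width k).
    - rewrite Nat.mul_comm. apply Nat.Div0.mul_div_le.
    - apply Nat.Div0.div_lt_upper_bound. lia. }
  assert (Heven : exists y, 2 ^ beta = 2 * y).
  { exists (2 ^ (beta - 1)). rewrite <- Nat.pow_succ_r'. f_equal. lia. }
  destruct Heven as [y Hy]. rewrite Hy in *.
  assert (b * (2 * y) + 1 < 2 * X) by lia. nia.
Qed.

Definition block_ranks (k b : nat) : nat :=
  pack beta (fun m => rank k (b * 2 ^ beta + m) - rank k (b * 2 ^ beta)) (2 ^ beta).

Lemma block_field k b m :
  m < 2 ^ beta -> rank k (b * 2 ^ beta + m) - rank k (b * 2 ^ beta) < 2 ^ beta.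
Proof. pose proof (rank_shift k (b * 2 ^ beta) m). lia. Qed.

Lemma block_ranks_lt k b : block_ranks k b < 2 ^ w.
Proof.
  apply Nat.lt_le_trans with (2 ^ (beta * 2 ^ beta)).
  - apply pack_lt. intros m. apply block_field.
  - apply Nat.pow_le_mono_r; lia.
Qed.

Lemma block_ranks_correct k b m :
  m < 2 ^ beta ->
  rank k (b * 2 ^ beta) + block_ranks k b / 2 ^ (beta * m) mod 2 ^ beta =
  rank k (b * 2 ^ beta + m).
Proof.
  intros Hm. unfold block_ranks. rewrite unpack; [|intros i; apply block_field|easy].
  pose proof (rank_shift k (b * 2 ^ beta) m). lia.
Qed.

Definition blocks : list (nat * nat) :=
  flat_map (fun i => let D := width (level i) in
    [(level i, st i / D / 2 ^ beta); (level i, (st (i + 1) - 1) / D / 2 ^ beta)]) (seq 1 t).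

Lemma length_blocks : length blocks = 2 * t.
Proof.
  unfold blocks. rewrite <- (length_seq t 1) at 2.
  induction (seq 1 t); simpl in *; lia.
Qed.

(** A phrase is at most one block long, so each of its positions lies in the block of its first or
    of its last position. *)
Lemma in_blocks i r :
  contains i r ->
  In (level i, r / width (level i) / 2 ^ beta) blocks.
Proof.
  intros [Hi Hr]. unfold blocks. apply in_flat_map. exists i.
  split; [apply in_seq; lia|]. cbv zeta.
  set (k := level i). pose proof (width_pos k). pose proof (pow2_pos beta).
  pose proof (len_le_width i) as Hl. fold k in Hl. rewrite Nat.add_1_r, width_succ in Hl.
  pose proof (st_len i Hi) as Hs.
  rewrite !Nat.Div0.div_div. set (Y := width k * 2 ^ beta) in *.
  assert (H1 : st i / Y <= r / Y) by (apply Nat.Div0.div_le_mono; lia).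
  assert (H2 : r / Y <= (st (i + 1) - 1) / Y) by (apply Nat.Div0.div_le_mono; lia).
  assert (H3 : (st (i + 1) - 1) / Y <= st i / Y + 1).
  { rewrite <- Nat.div_add by nia. apply Nat.Div0.div_le_mono. lia. }
  destruct (Nat.eq_dec (r / Y) (st i / Y)) as [->|]; [now left|].
  right; left. f_equal. lia.
Qed.

Lemma blocks_key_lt k b : In (k, b) blocks -> key k b < 2 ^ w.
Proof.
  unfold blocks. rewrite in_flat_map. intros (i & Hi%in_seq & H).
  pose proof (level_bound i ltac:(lia)).
  pose proof (st_step i ltac:(lia)). pose proof (st_next i (t + 1) ltac:(lia) ltac:(lia)).
  destruct H as [[= <- <-]|[[= <- <-]|[]]]; apply key_lt; lia.
Qed.

(* Words looked up for keys of no block are arbitrary, but still lead to an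
   index of [order]; the query then detects that the phrase found is wrong. *)
Lemma block_tables :
  exists a1 sh1 (a o sh : nat -> nat) T (base ranks : nat -> nat),
    a1 < 2 ^ w /\ sh1 <= w /\ 2 ^ (w - sh1) <= 36 * t /\ T <= 36 * t /\ T <= 2 ^ w /\
    (forall i, i < 2 ^ (w - sh1) -> a i < 2 ^ w /\ sh i <= w /\ o i + 2 ^ (w - sh i) <= T) /\
    (forall j, base j < 2 ^ w /\ ranks j < 2 ^ w) /\
    (forall j m, m < 2 ^ beta ->
       base j + ranks j / 2 ^ (beta * m) mod 2 ^ beta < length order) /\
    (forall i r, contains i r ->
       let k := level i in let s := r / width k in
       let j := slot w a1 sh1 a o sh (key k (s / 2 ^ beta)) in
       base j + ranks j / 2 ^ (beta * (s mod 2 ^ beta)) mod 2 ^ beta = rank k s).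
Proof.
  set (keys := nodup Nat.eq_dec (map (fun p => key (fst p) (snd p)) blocks)).
  assert (Hin : forall k b, In (k, b) blocks -> In (key k b) keys).
  { intros k b H. apply nodup_In, in_map_iff. now exists (k, b). }
  assert (Hlen : length keys <= 2 * t).
  { rewrite <- length_blocks, <- (length_map (fun p => key (fst p) (snd p)) blocks).
    apply NoDup_incl_length; [apply NoDup_nodup|].
    intros x Hx. now apply nodup_In in Hx. }
  pose proof w_pos as Hw. pose proof order_nonempty as Hne. pose proof length_order_le as Hle.
  destruct (perfect_hash w keys) as (a1 & sh1 & a & o & sh & T & Ha1 & Hsh1 & Hm & HT & HTw & Hi & Hinj).
  - lia.
  - apply NoDup_nodup.
  - apply Forall_forall. intros x Hx%nodup_In.
    apply in_map_iff in Hx as ([k b] & <- & Hkb). now apply blocks_key_lt.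
  - intros E. assert (H1 : contains 1 0).
    { split; [lia|]. pose proof (st_step 1 ltac:(lia)). lia. }
    apply in_blocks, Hin in H1. now rewrite E in H1.
  - set (f := slot w a1 sh1 a o sh) in *.
    (* A slot is filled by searching for a block hashed to it; injectivity of slots on keys, and of
       keys on blocks, makes the search return the right block. *)
    set (find_block := fun j => find (fun p => f (key (fst p) (snd p)) =? j) blocks).
    exists a1, sh1, a, o, sh, T,
      (fun j => match find_block j with Some (k, b) => rank k (b * 2 ^ beta) | None => 0 end),
      (fun j => match find_block j with Some (k, b) => block_ranks k b | None => 0 end).
    pose proof count_le_n.
    repeat split; try easy; try lia; try (now apply Hi).
    + destruct (find_block j) as [[k b]|]; [|apply pow2_pos].
      pose proof (rank_lt k (b * 2 ^ beta)). lia.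
    + destruct (find_block j) as [[k b]|]; [apply block_ranks_lt|apply pow2_pos].
    + intros j m Hm'. destruct (find_block j) as [[k b]|].
      * rewrite block_ranks_correct by easy. apply rank_lt.
      * now rewrite !Nat.Div0.div_0_l, Nat.Div0.mod_0_l.
    + intros i r Hc k s j. pose proof (in_blocks i r Hc) as Hb. fold k s in Hb.
      assert (E : find_block j = Some (k, s / 2 ^ beta)).
      { unfold find_block. destruct (find _ blocks) as [[k' b']|] eqn:E.
        - apply find_some in E as [Hb' Hj%Nat.eqb_eq]. simpl in Hj.
          apply Hinj in Hj; [|auto|auto]. apply key_inj in Hj as [-> ->]. easy.
        - apply (find_none _ _ E) in Hb. simpl in Hb. now rewrite Nat.eqb_refl in Hb. }
      rewrite E, block_ranks_correct by (apply Nat.mod_upper_bound; pose proof (pow2_pos beta); lia).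
      f_equal. rewrite (Nat.div_mod_eq s (2 ^ beta)) at 3. lia.
Qed.

(** * Correctness of the query program *)

Section Query.

Variables (a1 sh1 : nat) (a o sh : nat -> nat) (T : nat) (base ranks : nat -> nat).
Hypothesis sh1_le : sh1 <= w.
Hypothesis T_le : T <= 2 ^ w.
Hypothesis second_level_ok :
  forall i, i < 2 ^ (w - sh1) -> a i < 2 ^ w /\ sh i <= w /\ o i + 2 ^ (w - sh i) <= T.
Hypothesis rank_in_order :
  forall j m, m < 2 ^ beta ->
    base j + ranks j / 2 ^ (beta * m) mod 2 ^ beta < length order.
Hypothesis ranks_found :
  forall i r, contains i r ->
    let k := level i in let s := r / width k in
    let j := slot w a1 sh1 a o sh (key k (s / 2 ^ beta)) in
    base j + ranks j / 2 ^ (beta * (s mod 2 ^ beta)) mod 2 ^ beta = rank k s.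

(* A phrase of kind 0 is explicit; its source is its place in the
   concatenation of the explicit phrases. *)
Variables (src entry kind : nat -> nat) (g b nlit : nat) (lit : nat -> nat).
Variable extra : nat.
Hypothesis src_lt : forall i r, contains i r -> src i + (r - st i) < 2 ^ w.
Hypothesis entry_lt : forall i, 1 <= i <= t -> beta * entry i < w.
Hypothesis entry_above :
  forall i j r, contains i r -> kind i = 1 -> contains j (src i + (r - st i)) ->
    level j <= entry i <= level i + extra.

Definition query_tables : list (list nat) :=
  [[2 ^ beta]; [beta]; [a1]; [sh1]; [g]; [b]; [2 ^ b - 1];
   table a (2 ^ (w - sh1)); table o (2 ^ (w - sh1)); table sh (2 ^ (w - sh1));
   table base T; table ranks T;
   map st order; map (fun i => len i - 1) order;
   map src order; map (fun i => width (entry i)) order;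
   map kind order; table lit nlit].

Let M : memory := map words query_tables.

Definition has_constants (rho : registers) : Prop :=
  rho 10 = N.of_nat (2 ^ beta) /\ rho 11 = N.of_nat beta /\
  rho 12 = N.of_nat a1 /\ rho 13 = N.of_nat sh1 /\ rho 14 = N.of_nat g /\
  rho 15 = N.of_nat b /\ rho 16 = N.of_nat (2 ^ b - 1) /\
  rho 17 = N.of_nat 1 /\ rho 18 = N.of_nat 0.

(** For [r] before the phrase the wrapped difference is at least [len i], because the phrase ends at
    or before 2^w. *)
Lemma outside_detected i r :
  In i order -> r < 2 ^ w ->
  let d := (r + 2 ^ w - st i) mod 2 ^ w in
  (contains i r /\ (len i - 1 <? d) = false /\ d = r - st i) \/
  (~ contains i r /\ (len i - 1 <? d) = true).
Proof.
  intros Hi%in_order Hr d.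
  pose proof (st_len i Hi) as Hl.
  pose proof (len_pos i Hi) as Hp.
  pose proof (st_next i (t + 1) ltac:(lia) ltac:(lia)) as Hn.
  rewrite st_last in Hn. unfold contains.
  destruct (le_lt_dec (st i) r) as [Hle|Hlt].
  - assert (Hd : d = r - st i).
    { subst d. replace (r + 2 ^ w - st i) with (r - st i + 1 * 2 ^ w) by lia.
      rewrite Nat.Div0.mod_add. apply Nat.mod_small. lia. }
    destruct (Nat.ltb_spec (len i - 1) d); [right|left]; repeat split; lia.
  - right. split; [lia|]. apply Nat.ltb_lt. subst d.
    rewrite Nat.mod_small; lia.
Qed.

Ltac get := cbv beta iota delta [set_reg Nat.eqb]; (reflexivity || eassumption).

Ltac op := eapply steps_op; [get | get | cbv beta iota delta [nat_op]; reflexivity | ].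

Lemma check_steps p rho Q k r c i :
  rho 0 = N.of_nat r -> rho 32 = N.of_nat c -> nth_error order c = Some i ->
  (let d := (r + 2 ^ w - st i) mod 2 ^ w in
   forall rho', (forall x, x <> 33 -> x <> 34 -> x <> 35 -> x <> 36 -> rho' x = rho x) ->
     rho' 35 = N.of_nat d -> rho' 36 = N.of_nat (Nat.b2n (len i - 1 <? d)) ->
     steps w M p rho' Q k) ->
  steps w M (seqs check p) rho Q (4 + k).
Proof.
  intros H0 H32 Hc H. unfold check, seqs. simpl Nat.add.
  eapply steps_fetch; [get|exact (nth_error_words_map st _ _ _ Hc)|].
  eapply steps_fetch; [get|exact (nth_error_words_map (fun i => len i - 1) _ _ _ Hc)|].
  op. op. apply H.
  - intros x H33 H34 H35 H36. unfold set_reg.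
    destruct (Nat.eqb_spec x 36), (Nat.eqb_spec x 35), (Nat.eqb_spec x 34),
      (Nat.eqb_spec x 33); easy.
  - reflexivity.
  - reflexivity.
Qed.

Lemma seqs_app l l' p : seqs (l ++ l') p = seqs l (seqs l' p).
Proof. induction l; simpl; congruence. Qed.

(** A hit is certified by the position test alone, whatever the level of the phrase. A miss is
    conclusive because the indices tested include every place in [order] that [rank_correct] leaves
    to a phrase of level [e] containing [r]. *)
Lemma probe_steps p rho Q k e r :
  has_constants rho -> rho 0 = N.of_nat r -> rho 1 = N.of_nat (width e) ->
  r < 2 ^ w -> beta * e < w ->
  (forall rho' c i miss,
     (forall x, x < 20 -> rho' x = rho x) ->
     rho' 32 = N.of_nat c -> nth_error order c = Some i ->
     rho' 36 = N.of_nat (Nat.b2n miss) ->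
     (if miss then forall j, contains j r -> level j <> e
      else contains i r /\ rho' 35 = N.of_nat (r - st i)) ->
     steps w M p rho' Q k) ->
  steps w M (seqs probe p) rho Q (31 + k).
Proof.
  intros (H10 & H11 & H12 & H13 & _ & _ & _ & H17 & H18) H0 H1 Hr He H.
  pose proof (pow2_pos w) as Hw. pose proof (pow2_pos beta) as HB.
  pose proof (key_lt e r He Hr) as Hkey.
  set (s := r / width e). set (x := key e (s / 2 ^ beta)) in *.
  fold s in Hkey. fold x in Hkey.
  unfold probe. rewrite !seqs_app. change (31 + k) with (20 + (4 + (3 + (4 + k)))).
  cbn [seqs Nat.add].
  op. fold s. op. op. op. op. op.
  assert (Hx : nat_op w Mul (((s / 2 ^ beta * 2 ^ beta) mod 2 ^ w + 1) mod 2 ^ w) (width e) = x).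
  { unfold nat_op. rewrite Nat.Div0.add_mod_idemp_l, Nat.Div0.mul_mod_idemp_l.
    now apply Nat.mod_small. }
  unfold nat_op in Hx. rewrite Hx.
  op. op. fold (hash w a1 sh1 x). set (i1 := hash w a1 sh1 x).
  assert (Hi1 : i1 < 2 ^ (w - sh1)) by now apply hash_lt.
  destruct (second_level_ok i1 Hi1) as (Ha & Hsh & HT).
  eapply steps_fetch; [get|now apply nth_error_table|].
  eapply steps_fetch; [get|now apply nth_error_table|].
  eapply steps_fetch; [get|now apply nth_error_table|].
  op. op. fold (hash w (a i1) (sh i1) x). op.
  pose proof (hash_lt w (a i1) (sh i1) x Hsh) as Hh.
  rewrite (Nat.mod_small (o i1 + _)) by lia.
  fold (slot w a1 sh1 a o sh x). set (j := slot w a1 sh1 a o sh x).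
  assert (Hj : j < T) by (unfold j, slot; fold i1; lia).
  eapply steps_fetch; [get|now apply nth_error_table|].
  eapply steps_fetch; [get|now apply nth_error_table|].
  assert (Hm : s mod 2 ^ beta < 2 ^ beta) by (apply Nat.mod_upper_bound; lia).
  pose proof (rank_in_order j _ Hm) as Hin.
  assert (Ht : length order <= 2 ^ w).
  { pose proof (length_order_le). pose proof (count_le_n).
    lia. }
  assert (Hbm : beta * (s mod 2 ^ beta) < 2 ^ w).
  { apply Nat.lt_trans with w; [|apply Nat.pow_gt_lin_r; lia]. nia. }
  op. rewrite (Nat.mod_small (beta * _)) by easy. op. op. op.
  set (c := base j + _) in *. rewrite (Nat.mod_small c) by lia.
  destruct (nth_error order c) as [i|] eqn:Ei; [|apply nth_error_None in Ei; lia].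
  match goal with |- steps _ _ _ ?R _ _ => set (rho1 := R) end.
  assert (Hlow : forall x, x < 20 -> rho1 x = rho x).
  { intros y Hy. unfold rho1, set_reg.
    do 20 (destruct y as [|y]; [reflexivity|]). lia. }
  assert (Hin_i : In i order) by now apply nth_error_In in Ei.
  change (S (S (S (S (S (S (S (S (S (S (S k))))))))))) with (4 + (3 + (4 + k))).
  eapply check_steps; [rewrite Hlow; [eassumption|lia]|reflexivity|exact Ei|].
  intros d rho2 Hrho2 H35 H36.
  pose proof (outside_detected i r Hin_i Hr) as Hdet. cbv zeta in Hdet. fold d in Hdet.
  remember (len i - 1 <? d) as miss eqn:Emiss. clear Emiss.
  assert (E18 : rho2 18 = N.of_nat 0) by (rewrite Hrho2, Hlow by lia; easy).
  assert (E32 : rho2 32 = N.of_nat c) by (rewrite Hrho2 by lia; easy).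
  cbn [seqs Nat.add]. op. op. op.
  set (c' := (c + 2 ^ w - _) mod 2 ^ w).
  (* At c = 0 nothing is subtracted, in agreement with truncated subtraction. *)
  assert (Hc' : c' = if miss then c - 1 else c).
  { assert (H2w : 2 <= 2 ^ w).
    { pose proof w_pos.
      change 2 with (2 ^ 1) at 1. apply Nat.pow_le_mono_r; lia. }
    unfold c'. destruct miss, (Nat.ltb_spec 0 c); cbn [Nat.b2n Nat.mul Nat.add];
      rewrite ?Nat.Div0.mod_0_l, ?(Nat.mod_small 1) by lia.
    - replace (c + 2 ^ w - 1) with (c - 1 + 1 * 2 ^ w) by lia.
      rewrite Nat.Div0.mod_add. apply Nat.mod_small. lia.
    - replace (c + 2 ^ w - 0) with (c + 1 * 2 ^ w) by lia.
      rewrite Nat.Div0.mod_add, Nat.mod_small; lia.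
    - replace (c + 2 ^ w - 0) with (c + 1 * 2 ^ w) by lia.
      rewrite Nat.Div0.mod_add, Nat.mod_small; lia.
    - replace (c + 2 ^ w - 0) with (c + 1 * 2 ^ w) by lia.
      rewrite Nat.Div0.mod_add, Nat.mod_small; lia. }
  assert (Ec' : exists i', nth_error order c' = Some i').
  { destruct (nth_error order c') as [i'|] eqn:E; [eauto|].
    apply nth_error_None in E. destruct miss; lia. }
  destruct Ec' as [i' Ei'].
  change (S (S (S (S k)))) with (4 + k).
  eapply check_steps; [cbv beta iota delta [set_reg Nat.eqb]; rewrite Hrho2, Hlow by lia; eassumption
    |reflexivity|exact Ei'|].
  intros d' rho3 Hrho3 H35' H36'.
  assert (Hin_i' : In i' order) by now apply nth_error_In in Ei'.
  pose proof (outside_detected i' r Hin_i' Hr) as Hdet'. cbv zeta in Hdet'. fold d' in Hdet'.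
  remember (len i' - 1 <? d') as miss' eqn:Emiss'. clear Emiss'.
  apply (H rho3 c' i' miss').
  - intros y Hy. rewrite Hrho3 by lia. unfold set_reg.
    destruct (Nat.eqb_spec y 32), (Nat.eqb_spec y 37); try lia. rewrite Hrho2, Hlow; lia || easy.
  - rewrite Hrho3 by lia. reflexivity.
  - exact Ei'.
  - exact H36'.
  - destruct miss'.
    + intros l Hl Ele.
      pose proof (ranks_found l r Hl) as Hf. cbv zeta in Hf.
      rewrite Ele in Hf. fold s x j c in Hf.
      pose proof (rank_correct l r Hl)
        as Hrank. cbv zeta in Hrank.
      rewrite Ele in Hrank. fold s in Hrank. rewrite <- Hf in Hrank.
      destruct Hdet' as [(_ & Hfalse & _)|[Hno _]]; [easy|].
      destruct Hdet as [(Hyes & Em & _)|[Hno1 Em]]; rewrite Em in Hc'; subst c'.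
      * rewrite Hc', Ei in Ei'. injection Ei' as <-. easy.
      * destruct Hrank as [E|[_ E]].
        -- rewrite Ei in E. injection E as <-. easy.
        -- rewrite Hc', E in Ei'. injection Ei' as <-. easy.
    + destruct Hdet' as [(Hyes & _ & Hd)|[_ Hfalse]]; [|easy].
      now rewrite H35', Hd.
Qed.


(** The height recast on 0-based positions: [h] copy steps, then the place in the concatenated
    explicit phrases with which register 0 is left. *)
Inductive reaches : nat -> nat -> nat -> Prop :=
| reaches_explicit i r :
    contains i r -> kind i = 0 -> reaches 0 r (src i + (r - st i))
| reaches_copy i h r x :
    contains i r -> kind i = 1 -> reaches h (src i + (r - st i)) x -> reaches (S h) r x.

Definition scanning (rho : registers) (r e : nat) (up : bool) : Prop :=
  has_constants rho /\ rho 0 = N.of_nat r /\ rho 1 = N.of_nat (width e) /\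
  rho 2 = N.of_nat (if up then 2 ^ beta else 1) /\
  rho 3 = N.of_nat (if up then 1 else 2 ^ beta) /\ rho 4 = 1%N.

Lemma has_constants_ext rho rho' :
  (forall x, 10 <= x <= 18 -> rho' x = rho x) -> has_constants rho -> has_constants rho'.
Proof. intros E. unfold has_constants. rewrite !E by lia. easy. Qed.

(** One round costs 31 for the lookup, 1 each for the loop test and the branch, and at most 6 for
    the code chosen, the jump being the longer: 39 in total. *)
Lemma body_steps rho Q k r e up i :
  scanning rho r e up -> contains i r -> beta * e < w ->
  (level i <> e -> forall rho',
     has_constants rho' -> rho' 0 = N.of_nat r ->
     rho' 1 = N.of_nat ((width e * (if up then 2 ^ beta else 1)) mod 2 ^ w /
                        (if up then 1 else 2 ^ beta)) ->
     (forall x, 2 <= x <= 4 -> rho' x = rho x) -> steps w M (While 4 body) rho' Q k) ->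
  (forall rho',
     has_constants rho' -> rho' 0 = N.of_nat (src i + (r - st i)) ->
     rho' 1 = N.of_nat (width (entry i)) -> rho' 2 = N.of_nat 1 ->
     rho' 3 = N.of_nat (2 ^ beta) -> rho' 4 = N.of_nat (kind i) ->
     steps w M (While 4 body) rho' Q k) ->
  steps w M (While 4 body) rho Q (39 + k).
Proof.
  intros (Hc & H0 & H1 & H2 & H3 & H4) Hi He Hmiss Hhit.
  pose proof (contains_lt i r Hi) as Hr.
  replace (39 + k) with (38 + k + 1) by lia.
  apply steps_while; [easy|]. unfold body.
  change 38 with (31 + 7).
  eapply probe_steps; [eassumption|eassumption|eassumption|lia|easy|].
  intros rho1 c j miss Hlow H32 Hj H36 Hres.
  change 7 with (6 + 1). apply steps_if with miss; [easy|].
  pose proof (has_constants_ext rho rho1 ltac:(intros; apply Hlow; lia) Hc) as Hc1.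
  rewrite <- (Hlow 0) in H0 by lia. rewrite <- (Hlow 1) in H1 by lia.
  rewrite <- (Hlow 2) in H2 by lia. rewrite <- (Hlow 3) in H3 by lia.
  destruct miss.
  - unfold change_level.
    apply (steps_weaken _ _ _ _ (fun rho' => steps w M (While 4 body) rho' Q k) _ 2); [|lia|easy].
    op. op. apply steps_skip. apply Hmiss.
    + now apply Hres.
    + revert Hc1. apply has_constants_ext. intros x Hx. unfold set_reg.
      destruct (Nat.eqb_spec x 1); [lia|easy].
    + exact H0.
    + reflexivity.
    + intros x Hx. unfold set_reg. destruct (Nat.eqb_spec x 1); [lia|]. apply Hlow. lia.
  - destruct Hres as [Hjr H35].
    assert (j = i) as -> by (eapply contains_unique; eassumption).
    destruct Hc1 as (E10 & E11 & E12 & E13 & E14 & E15 & E16 & E17 & E18).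
    unfold jump. cbn [seqs].
    pose proof (pow2_pos w) as Hw.
    assert (H2w : 2 ^ beta < 2 ^ w /\ 1 < 2 ^ w).
    { pose proof two_le_pow_beta. assert (beta < w) by nia.
      assert (2 ^ beta < 2 ^ w) by (apply Nat.pow_lt_mono_r; lia). lia. }
    eapply steps_fetch; [get|exact (nth_error_words_map src _ _ _ Hj)|].
    op.
    eapply steps_fetch; [get|exact (nth_error_words_map (fun i => width (entry i)) _ _ _ Hj)|].
    eapply steps_fetch; [get|exact (nth_error_words_map kind _ _ _ Hj)|].
    op. op. apply steps_skip. apply Hhit.
    + unfold has_constants, set_reg. cbn [Nat.eqb]. repeat split; assumption.
    + cbv beta iota delta [set_reg Nat.eqb]. f_equal. apply Nat.mod_small. auto.
    + reflexivity.
    + cbv beta iota delta [set_reg Nat.eqb]. f_equal. apply Nat.mod_small. lia.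
    + cbv beta iota delta [set_reg Nat.eqb]. f_equal. rewrite Nat.add_0_r. apply Nat.mod_small. lia.
    + reflexivity.
Qed.

Definition found (rho : registers) (i r : nat) : Prop :=
  has_constants rho /\ rho 0 = N.of_nat (src i + (r - st i)) /\
  rho 1 = N.of_nat (width (entry i)) /\ rho 2 = N.of_nat 1 /\
  rho 3 = N.of_nat (2 ^ beta) /\ rho 4 = N.of_nat (kind i).

Lemma scan_phrase i r Q k :
  contains i r ->
  (forall rho, found rho i r -> steps w M (While 4 body) rho Q k) ->
  forall d e up rho,
    scanning rho r e up -> beta * e < w ->
    (if up then e + d = level i else e = level i + d) ->
    steps w M (While 4 body) rho Q (39 * (d + 1) + k).
Proof.
  intros Hi Hfound. pose proof (level_bound i (proj1 Hi)) as Hlevel.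
  pose proof (pow2_pos w) as Hw. pose proof (pow2_pos beta) as HB.
  assert (Hpow : forall e, beta * e < w -> width e < 2 ^ w)
    by (intros; apply Nat.pow_lt_mono_r; lia).
  induction d as [|d IH]; intros e up rho Hs He Hd.
  - replace (39 * (0 + 1) + k) with (39 + k) by lia.
    apply (body_steps rho Q k r e up i Hs Hi He).
    + destruct up; lia.
    + intros. apply Hfound. unfold found. auto 10.
  - replace (39 * (S d + 1) + k) with (39 + (39 * (d + 1) + k)) by lia.
    pose proof Hs as (_ & _ & _ & E2 & E3 & E4).
    apply (body_steps rho Q _ r e up i Hs Hi He).
    + intros Hne rho' Hc' H0' H1' Hlow.
      set (e' := if up then e + 1 else e - 1).
      assert (He' : beta * e' < w) by (destruct up; unfold e'; nia).
      apply (IH e' up); [|easy|destruct up; unfold e'; lia].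
      rewrite <- (Hlow 2) in E2 by lia. rewrite <- (Hlow 3) in E3 by lia.
      rewrite <- (Hlow 4) in E4 by lia.
      split; [easy|]. split; [easy|]. split; [|easy].
      rewrite H1'. f_equal. pose proof (Hpow e He). pose proof (Hpow e' He').
      destruct up; unfold e' in *.
      * rewrite Nat.div_1_r, <- width_succ, <- Nat.add_1_r. now apply Nat.mod_small.
      * rewrite Nat.mul_1_r, Nat.mod_small by easy.
        replace e with (S (e - 1)) at 1 by lia. rewrite width_succ. apply Nat.div_mul. lia.
    (* A lookup at another level may hit phrase [i] by chance; the search then ends early. *)
    + intros. apply steps_weaken with Q k; [|lia|easy].
      apply Hfound. unfold found. auto 10.
Qed.

(* Descending from the entry level of a phrase to the level of the next phrase
   costs their difference, so the sum over all jumps telescopes. *)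
Lemma scan_steps h r x :
  reaches h r x ->
  forall i d e up rho,
    contains i r -> scanning rho r e up -> beta * e < w ->
    (if up then e + d = level i else e = level i + d) ->
    steps w M (While 4 body) rho
      (fun rho' => has_constants rho' /\ rho' 0 = N.of_nat x)
      (39 * (d + 1 + level i + h * (extra + 1)) + 1).
Proof.
  induction 1 as [i' r Hi' Hk|i' h r x Hi' Hk Hreach IH]; intros i d e up rho Hi Hs He Hd;
    (assert (i' = i) as -> by (eapply contains_unique; eassumption)).
  - eapply steps_weaken with (k := 39 * (d + 1) + 1); [|lia|intros rho' H; exact H].
    eapply scan_phrase; try eassumption.
    intros rho' (Hc & H0 & _ & _ & _ & H4). rewrite Hk in H4.
    apply steps_while_stop; easy.
  - set (k := 39 * (level i + extra + 1 + h * (extra + 1)) + 1).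
    eapply steps_weaken with (k := 39 * (d + 1) + k); [|unfold k; lia|intros rho' H; exact H].
    eapply scan_phrase; try eassumption.
    intros rho' (Hc & H0 & H1 & H2 & H3 & H4). rewrite Hk in H4.
    assert (Hj : exists j, contains j (src i + (r - st i)))
      by (inversion Hreach; eauto).
    destruct Hj as [j Hj].
    pose proof (entry_above i j r Hi Hk Hj) as [Hle Hge].
    eapply steps_weaken; [apply (IH j (entry i - level j) (entry i) false)| |intros ? H; exact H].
    + exact Hj.
    + unfold scanning. auto 10.
    + apply entry_lt, Hi.
    + lia.
    + unfold k. lia.
Qed.

Variable chars : nat -> nat.
Hypothesis b_le : 1 <= b <= w.
Hypothesis g_le : 1 <= g /\ g * b <= w.
Hypothesis lit_correct : forall h r x, reaches h r x ->
  x / g < nlit /\ lit (x / g) / 2 ^ (b * (x mod g)) mod 2 ^ b = chars r.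

Hypothesis constants_lt : a1 < 2 ^ w.

Lemma query_steps h r x i :
  reaches h r x -> contains i r ->
  steps w M query (set_reg (fun _ => 0%N) 0 (N.of_nat r))
    (fun rho => rho 0 = N.of_nat (chars r))
    (39 * (2 * level i + 1 + h * (extra + 1)) + 19).
Proof.
  intros Hreach Hi. pose proof (contains_lt i r Hi) as Hr.
  pose proof w_pos as Hw2. pose proof two_le_pow_beta as HB2.
  assert (H2w : 2 < 2 ^ w /\ 2 ^ beta < 2 ^ w).
  { assert (beta < w) by nia. assert (2 ^ beta < 2 ^ w) by (apply Nat.pow_lt_mono_r; lia).
    assert (2 ^ 2 <= 2 ^ w) by (apply Nat.pow_le_mono_r; lia). simpl in *; lia. }
  (* [init] takes 12 steps and [extract] 6; with the last loop test they make 19. *)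
  set (k := 39 * (level i + 1 + level i + h * (extra + 1)) + 1 + 6).
  replace (39 * _ + 19) with (12 + k) by (unfold k; lia).
  set (rho := set_reg _ 0 _).
  assert (H0 : rho 0 = N.of_nat r) by easy. assert (H18 : rho 18 = N.of_nat 0) by easy.
  clearbody rho. unfold query, init. cbn [app seqs Nat.add].
  do 7 (eapply steps_fetch; [get|reflexivity|]).
  apply (steps_const _ _ 17 1); [lia|].
  op. op. op. op. rewrite !Nat.add_0_r, !(Nat.mod_small 1), !(Nat.mod_small (2 ^ beta)) by lia.
  unfold k. apply steps_seq.
  eapply steps_weaken; [apply (scan_steps h r x Hreach i (level i) 0 true _ Hi)|lia|].
  - unfold scanning, has_constants, set_reg. cbn [Nat.eqb].
    unfold width. rewrite Nat.mul_0_r. repeat split; assumption || reflexivity.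
  - lia.
  - lia.
  - intros rho1 [(_ & _ & _ & _ & E14 & E15 & E16 & _ & _) E0].
    destruct (lit_correct h r x Hreach) as [Hx Hlit].
    assert (Hxg : x mod g < g) by (apply Nat.mod_upper_bound; lia).
    assert (Hb : b * (x mod g) < 2 ^ w).
    { apply Nat.lt_trans with w; [nia|]. apply Nat.pow_gt_lin_r; lia. }
    unfold extract. cbn [seqs].
    op. eapply steps_fetch; [get|now apply nth_error_table|].
    op. op. rewrite (Nat.mod_small (b * _)) by easy. op.
    eapply steps_op; [get|get|rewrite nat_op_and_mask; exact Hlit|].
    now apply steps_skip.
Qed.

Lemma query_memory_ok :
  (forall j, base j < 2 ^ w /\ ranks j < 2 ^ w) -> (forall i, kind i <= 1) ->
  (forall j, lit j < 2 ^ w) -> memory_ok w M.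
Proof.
  intros Hbr Hkind Hlit.
  pose proof w_pos as Hw2. pose proof two_le_pow_beta as HB2.
  assert (Hww : w < 2 ^ w) by (apply Nat.pow_gt_lin_r; lia).
  assert (HB : 2 ^ beta < 2 ^ w) by (apply Nat.pow_lt_mono_r; [lia|nia]).
  assert (Hb : 2 ^ b <= 2 ^ w) by (apply Nat.pow_le_mono_r; lia).
  assert (Hb0 : 0 < 2 ^ b) by apply pow2_pos.
  assert (Hwords : forall l, Forall (fun v => v < 2 ^ w) l -> Forall (is_word w) (words l)).
  { intros l H. unfold words. apply Forall_map. revert H. apply Forall_impl.
    intros v Hv. unfold is_word. rewrite <- of_nat_pow2. lia. }
  assert (Htable : forall f m, (forall i, i < m -> f i < 2 ^ w) ->
            Forall (fun v => v < 2 ^ w) (table f m)).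
  { intros f m H. apply Forall_map, Forall_forall. intros i Hi%in_seq. apply H. lia. }
  assert (Horder : forall f, (forall i, 1 <= i <= t -> f i < 2 ^ w) ->
            Forall (fun v => v < 2 ^ w) (map f order)).
  { intros f H. apply Forall_map, Forall_forall. intros i Hi%in_order. auto. }
  assert (Hst : forall i, 1 <= i <= t -> st i + len i <= n).
  { intros i Hi. rewrite <- st_len, <- st_last by easy.
    apply (st_next i (t + 1)); lia. }
  unfold memory_ok, M, query_tables.
  assert (Hfit : beta <= w /\ g <= w) by nia.
  cbn [map]. repeat match goal with |- Forall _ (_ :: _) => constructor end;
    try (apply Hwords); try (constructor; [lia|constructor]).
  - apply Htable. intros i Hi. now apply second_level_ok.
  - apply Htable. intros i Hi. destruct (second_level_ok i Hi) as (_ & _ & H).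
    pose proof (pow2_pos (w - sh i)). lia.
  - apply Htable. intros i Hi. destruct (second_level_ok i Hi) as (_ & H & _). lia.
  - apply Htable. intros; apply Hbr.
  - apply Htable. intros; apply Hbr.
  - apply Horder. intros i Hi. specialize (Hst i Hi). pose proof (len_pos i Hi). lia.
  - apply Horder. intros i Hi. specialize (Hst i Hi). pose proof (len_pos i Hi). lia.
  - apply Horder. intros i Hi. specialize (src_lt i (st i)). unfold contains in src_lt.
    pose proof (st_step i Hi). lia.
  - apply Horder. intros i Hi. apply Nat.pow_lt_mono_r; [lia|]. now apply entry_lt.
  - apply Horder. intros i Hi. specialize (Hkind i). lia.
  - apply Htable. intros; apply Hlit.
  - constructor.
Qed.

Lemma query_memory_size : memory_size M <= 7 + 3 * 2 ^ (w - sh1) + 2 * T + 5 * t + nlit.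
Proof.
  pose proof length_order_le.
  unfold memory_size, M, query_tables, words, table. cbn [map list_sum fold_right length].
  rewrite !length_map, !length_seq. simpl. lia.
Qed.

End Query.

(** * The tables of a parse *)

Lemma phrase_of_contains P i r :
  nphrases P = t -> (forall i, 1 <= i <= t + 1 -> start P i = st i + 1) ->
  contains i r -> phrase_of P (r + 1) = i.
Proof.
  intros count_phrases starts [Hi Hr]. unfold phrase_of. rewrite count_phrases, (seq_split i Hi), filter_app, length_app.
  rewrite (filter_ext_in _ (fun _ => true) (seq 1 (i - 1))).
  - cbn [filter]. rewrite (filter_none _ (seq (i + 1) _)), filter_true, length_seq.
    + rewrite starts by lia. destruct (Nat.leb_spec (st i + 1) (r + 1)); simpl; lia.
    + intros j Hj%in_seq. rewrite starts by lia. apply Nat.leb_gt.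
      pose proof (st_next i j ltac:(lia) ltac:(lia)). lia.
  - intros j Hj%in_seq. rewrite starts by lia. apply Nat.leb_le.
    pose proof (st_next j i ltac:(lia) ltac:(lia)). pose proof (st_step j ltac:(lia)). lia.
Qed.

Variables (text : list nat) (P : parse) (b g A c : nat).
Hypothesis length_text : length text = n.
Hypothesis count_phrases : nphrases P = t.
Hypothesis starts : forall i, 1 <= i <= t + 1 -> start P i = st i + 1.
Hypothesis b_le : 1 <= b <= w.
Hypothesis g_le : 1 <= g /\ g * b <= w.
Hypothesis text_lt : Forall (fun x => x < 2 ^ b) text.
Hypothesis sources : forall i, 1 <= i <= t ->
  match source P i with
  | None => len i <= A * g
  | Some p => same_substring text p (start P i) (len i)
  end.
Hypothesis lengths : forall i p j r,
  1 <= i <= t -> source P i = Some p -> 1 <= j <= t ->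
  p <= r < p + len i -> in_phrase P j r -> len j <= w ^ c * len i.
Hypothesis w_lt : w < 2 ^ (3 * beta).

Definition explicit_text (i : nat) : list nat :=
  match source P i with
  | None => map (fun k => char text (start P i + k)) (seq 0 (len i))
  | Some _ => []
  end.

Definition literal : list nat := flat_map explicit_text (seq 1 t).

Definition phrase_source (i : nat) : nat :=
  match source P i with
  | None => length (flat_map explicit_text (seq 1 (i - 1)))
  | Some p => p - 1
  end.

Definition phrase_kind (i : nat) : nat :=
  match source P i with None => 0 | Some _ => 1 end.

(** Explicit phrases start no later in [literal] than in the text, so addresses in [literal] are
    words just as positions are. *)
Lemma literal_prefix_le m : m <= t -> length (flat_map explicit_text (seq 1 m)) <= st (m + 1).
Proof.
  induction m as [|m IH]; intros Hm; [simpl; lia|].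
  rewrite seq_S, flat_map_app, length_app. cbn [flat_map]. rewrite app_nil_r.
  specialize (IH ltac:(lia)). rewrite (st_len (S m)) by lia. rewrite Nat.add_1_r in IH.
  cbn [Nat.add]. unfold explicit_text at 2. destruct (source P (S m)); [simpl; lia|].
  rewrite length_map, length_seq. lia.
Qed.

Lemma literal_length_le : length literal <= t * (A * g).
Proof.
  unfold literal. rewrite <- (length_seq t 1) at 2.
  assert (H : forall i, In i (seq 1 t) -> 1 <= i <= t) by (intros i Hi%in_seq; lia).
  induction (seq 1 t) as [|i l IH]; [simpl; lia|].
  cbn [flat_map]. rewrite length_app. cbn [length].
  specialize (IH (fun j Hj => H j (or_intror Hj))).
  pose proof (sources i (H i (or_introl eq_refl))) as Hs.
  enough (length (explicit_text i) <= A * g) by lia.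
  unfold explicit_text. destruct (source P i); [simpl; lia|].
  now rewrite length_map, length_seq.
Qed.

Lemma phrase_source_lt i r : contains i r -> phrase_source i + (r - st i) < 2 ^ w.
Proof.
  intros [Hi Hr]. pose proof (sources i Hi) as Hs.
  pose proof (st_next i (t + 1) ltac:(lia) ltac:(lia)).
  unfold phrase_source. destruct (source P i) as [p|].
  - destruct Hs as (? & ? & ? & ? & _). rewrite starts in * by lia.
    pose proof (st_len i Hi). lia.
  - pose proof (literal_prefix_le (i - 1) ltac:(lia)) as Hl.
    replace (i - 1 + 1) with i in Hl by lia. lia.
Qed.

Lemma nth_literal i k :
  1 <= i <= t -> source P i = None -> k < len i ->
  phrase_source i + k < length literal /\
  nth (phrase_source i + k) literal 0 = char text (start P i + k).
Proof.
  intros Hi Hs Hk. unfold phrase_source, literal. rewrite Hs, (seq_split i Hi), flat_map_app.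
  cbn [flat_map].
  assert (Hl : length (explicit_text i) = len i)
    by (unfold explicit_text; now rewrite Hs, length_map, length_seq).
  split.
  - rewrite !length_app. lia.
  - rewrite app_nth2, Nat.add_comm, Nat.add_sub, app_nth1 by lia.
    unfold explicit_text. rewrite Hs.
    rewrite (nth_indep _ 0 (char text (start P i + 0))) by (rewrite length_map, length_seq; lia).
    rewrite (map_nth (fun k => char text (start P i + k))), seq_nth; easy.
Qed.

Lemma char_lt q : char text q < 2 ^ b.
Proof.
  unfold char. destruct (nth_in_or_default (q - 1) text 0) as [H| ->].
  - rewrite Forall_forall in text_lt. auto.
  - apply pow2_pos.
Qed.

Lemma literal_lt x : nth x literal 0 < 2 ^ b.
Proof.
  assert (Hin : forall v, In v literal -> v < 2 ^ b).
  { intros v (i & _ & H)%in_flat_map. unfold explicit_text in H.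
    destruct (source P i); [easy|]. apply in_map_iff in H as (k & <- & _). apply char_lt. }
  destruct (nth_in_or_default x literal 0) as [H| ->]; [auto|apply pow2_pos].
Qed.

Definition literal_word (j : nat) : nat := pack b (fun k => nth (j * g + k) literal 0) g.

Lemma literal_word_correct x :
  literal_word (x / g) / 2 ^ (b * (x mod g)) mod 2 ^ b = nth x literal 0.
Proof.
  unfold literal_word. rewrite unpack.
  - f_equal. rewrite (Nat.div_mod_eq x g) at 3. lia.
  - intros; apply literal_lt.
  - apply Nat.mod_upper_bound. lia.
Qed.

Lemma literal_word_lt j : literal_word j < 2 ^ w.
Proof.
  apply Nat.lt_le_trans with (2 ^ (b * g)).
  - apply pack_lt. intros; apply literal_lt.
  - apply Nat.pow_le_mono_r; lia.
Qed.

Lemma reaches_char h r x :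
  reaches phrase_source phrase_kind h r x ->
  x < length literal /\ nth x literal 0 = char text (r + 1).
Proof.
  induction 1 as [i r [Hi Hr] Hk|i h r x [Hi Hr] Hk _ [IH1 IH2]].
  - unfold phrase_kind in Hk. destruct (source P i) eqn:Hs; [easy|].
    pose proof (st_len i Hi).
    destruct (nth_literal i (r - st i) Hi Hs ltac:(lia)) as [H1 H2].
    split; [easy|]. rewrite H2, starts by lia. f_equal. lia.
  - split; [easy|]. rewrite IH2. unfold phrase_kind in Hk. unfold phrase_source.
    pose proof (sources i Hi) as Hs. destruct (source P i) as [p|]; [|easy].
    destruct Hs as (H1 & _ & _ & _ & H2). specialize (H2 (r - st i)).
    pose proof (st_len i Hi). rewrite starts in H2 by lia.
    replace (p - 1 + (r - st i) + 1) with (p + (r - st i)) by lia.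
    rewrite H2 by lia. f_equal. lia.
Qed.

Lemma height_reaches h q :
  1 <= q <= n -> height P q h ->
  exists x, reaches phrase_source phrase_kind h (q - 1) x.
Proof.
  revert q; induction h as [|h IH]; intros q Hq [Hexp Hcopy].
  all: destruct (contains_exists (q - 1) ltac:(lia)) as [i Hi];
    pose proof (phrase_of_contains P i _ count_phrases starts Hi) as Hpo; replace (q - 1 + 1) with q in Hpo by lia.
  - unfold explicit_pos in Hexp. simpl in Hexp. rewrite Hpo in Hexp.
    eexists. apply reaches_explicit; [exact Hi|]. unfold phrase_kind. now rewrite Hexp.
  - pose proof (Hcopy 0 ltac:(lia)) as Hne. unfold explicit_pos in Hne. simpl in Hne.
    rewrite Hpo in Hne.
    pose proof (sources i (proj1 Hi)) as Hs.
    destruct (source P i) as [p|] eqn:Hp; [|easy].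
    destruct Hs as (H1 & H2 & _). pose proof Hi as [Hit Hr].
    pose proof (st_len i Hit).
    assert (Hstep : parse_step P q = p + (q - 1 - st i)).
    { unfold parse_step. rewrite Hpo, Hp, starts by lia. lia. }
    destruct (IH (parse_step P q)) as [x Hx].
    + rewrite Hstep. lia.
    + split.
      * rewrite <- Nat.iter_succ_r. exact Hexp.
      * intros k Hk. rewrite <- Nat.iter_succ_r. apply Hcopy. lia.
    + exists x. apply reaches_copy with i; [easy|unfold phrase_kind; now rewrite Hp|].
      unfold phrase_source. rewrite Hp.
      replace (p - 1 + (q - 1 - st i)) with (parse_step P q - 1) by lia. exact Hx.
Qed.

(* Contraction bounds the level of the next phrase by [level i + extra_levels];
   the minimum keeps the corresponding width below 2^w. *)
Definition extra_levels : nat := 3 * c + 1.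

Definition entry_level (i : nat) : nat := min (level i + extra_levels) ((w - 1) / beta).

Lemma width_le_inv k l : width k <= width l -> k <= l.
Proof. intros H%Nat.pow_le_mono_r_iff; nia. Qed.

Lemma entry_level_lt i : beta * entry_level i < w.
Proof.
  pose proof w_pos. pose proof (Nat.Div0.mul_div_le (w - 1) beta).
  unfold entry_level. nia.
Qed.

(** width (level j) <= len j <= w^c * len i <= B^(3c) * B^(level i + 1), by contraction and w < B^3.
    The cap in [entry_level] is harmless, since the level of every phrase respects it. *)
Lemma entry_level_above i j r :
  contains i r -> phrase_kind i = 1 -> contains j (phrase_source i + (r - st i)) ->
  level j <= entry_level i <= level i + extra_levels.
Proof.
  intros [Hi Hr] Hk [Hj Hrj]. split; [|apply Nat.le_min_l].
  apply Nat.min_glb.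
  - unfold phrase_kind in Hk. unfold phrase_source in Hrj.
    pose proof (sources i Hi) as Hs. destruct (source P i) as [p|] eqn:Hp; [|easy].
    destruct Hs as (H1 & _). pose proof (st_len i Hi).
    assert (Hlen : len j <= w ^ c * len i).
    { apply (lengths i p j (p + (r - st i)) Hi Hp Hj); [lia|].
      unfold in_phrase. rewrite !starts by lia. lia. }
    apply width_le_inv.
    apply Nat.le_trans with (len j); [now apply width_level_le_len|].
    apply Nat.le_trans with (width (3 * c) * width (level i + 1)).
    + apply Nat.le_trans with (w ^ c * len i); [easy|].
      apply Nat.mul_le_mono; [|apply len_le_width].
      unfold width. replace (beta * (3 * c)) with (3 * beta * c) by ring.
      rewrite Nat.pow_mul_r. apply Nat.pow_le_mono_l. lia.
    + unfold width, extra_levels. rewrite <- Nat.pow_add_r.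
      apply Nat.pow_le_mono_r; [lia|]. nia.
  - pose proof (level_bound j Hj).
    apply Nat.div_le_lower_bound; lia.
Qed.

(** The 193 collects 7 constants, 5 hash tables of at most 36 t words, 5 arrays indexed like
    [order], and 1 for rounding up the literal words; [A] counts the rest of these. Single words are
    charged to t >= 1. *)
Lemma structure_exists :
  exists M, memory_ok w M /\ memory_size M <= (193 + A) * t /\
    forall q h i, 1 <= q <= n -> height P q h -> contains i (q - 1) ->
      exists T, access w M query text q T /\
        T <= 39 * (2 * level i + 1 + h * (3 * c + 2)) + 19.
Proof.
  destruct block_tables as (a1 & sh1 & a & o & sh & T & base & ranks &
    Ha1 & Hsh1 & Hm & HT & HTw & Hok & Hbr & Hin & Hfound).
  set (nlit := length literal / g + 1).
  assert (Hlit : forall h r x, reaches phrase_source phrase_kind h r x ->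
    x / g < nlit /\ literal_word (x / g) / 2 ^ (b * (x mod g)) mod 2 ^ b = char text (r + 1)).
  { intros h r x H. apply reaches_char in H as [H1 H2]. split.
    - unfold nlit. pose proof (Nat.Div0.div_le_mono x (length literal) g ltac:(lia)). lia.
    - now rewrite literal_word_correct. }
  exists (map words (query_tables a1 sh1 a o sh T base ranks phrase_source entry_level phrase_kind
    g b nlit literal_word)).
  split; [|split].
  - eapply query_memory_ok; try eassumption.
    + exact phrase_source_lt.
    + intros; apply entry_level_lt.
    + intros i. unfold phrase_kind. destruct (source P i); lia.
    + exact literal_word_lt.
  - eapply Nat.le_trans; [eapply query_memory_size; eassumption|].
    pose proof literal_length_le as HL.
    assert (Hd : length literal / g <= t * A).
    { apply Nat.Div0.div_le_upper_bound; lia. }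
    unfold nlit. nia.
  - intros q h i Hq Hh Hi. destruct (height_reaches h q Hq Hh) as [x Hx].
    destruct (query_steps a1 sh1 a o sh T base ranks Hsh1 HTw Hok Hin Hfound phrase_source
      entry_level phrase_kind g b nlit literal_word extra_levels phrase_source_lt
      (fun i _ => entry_level_lt i) entry_level_above (fun r => char text (r + 1)) b_le g_le
      Hlit Ha1 h (q - 1) x i Hx Hi) as (rho & T' & Hex & HT' & Hout).
    exists T'. split.
    + exists rho. split; [exact Hex|]. cbv beta in Hout. now replace (q - 1 + 1) with q in Hout by lia.
    + unfold extra_levels in HT'. lia.
Qed.

End Phrases.

(** * Logarithmic bounds *)

(** The largest [beta] with 2^beta * beta <= w works: maximality gives w < 2^(beta+1) * (beta+1) <=
    2^(2 beta + 1) <= 2^(3 beta). *)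
Lemma block_size_exists w :
  2 <= w -> exists beta, 1 <= beta /\ 2 ^ beta * beta <= w /\ w < 2 ^ (3 * beta).
Proof.
  intros Hw.
  assert (H : forall m, exists beta, 1 <= beta /\ 2 ^ beta * beta <= w /\
            (beta = S m \/ w < 2 ^ S beta * S beta)).
  { induction m as [|m (beta & H1 & H2 & H3)].
    - exists 1. simpl; lia.
    - destruct H3 as [->|H3]; [|exists beta; auto].
      destruct (le_lt_dec (2 ^ S (S m) * S (S m)) w) as [Hle|Hlt].
      + exists (S (S m)). repeat split; [lia|easy|now left].
      + exists (S m). repeat split; [lia|easy|now right]. }
  destruct (H w) as (beta & H1 & H2 & H3). exists beta. repeat split; [easy|easy|].
  destruct H3 as [->|H3].
  - pose proof (pow2_pos (S w)). exfalso. nia.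
  - apply Nat.lt_le_trans with (2 ^ S beta * S beta); [easy|].
    pose proof (Nat.pow_gt_lin_r 2 beta ltac:(lia)).
    apply Nat.le_trans with (2 ^ S beta * 2 ^ beta).
    + apply Nat.mul_le_mono_l. lia.
    + rewrite <- Nat.pow_add_r. apply Nat.pow_le_mono_r; lia.
Qed.

Lemma ln_INR_pow2 k : (ln (INR (2 ^ k)) = INR k * ln 2)%R.
Proof.
  rewrite pow_INR. replace (INR 2) with 2%R by (simpl; lra). apply ln_pow. lra.
Qed.

Lemma ln_INR_le x y : 1 <= x -> x <= y -> (ln (INR x) <= ln (INR y))%R.
Proof.
  intros Hx Hxy. destruct (Nat.eq_dec x y) as [->|Hne]; [lra|].
  apply Rlt_le, ln_increasing; [apply lt_0_INR|apply lt_INR]; lia.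
Qed.

Lemma ln2_pos : (0 < ln 2)%R.
Proof. rewrite <- ln_1. apply ln_increasing; lra. Qed.

Lemma log_ge_1 b x : (1 <= log b x)%R.
Proof. apply Rmax_l. Qed.

(** Two roundings cost a factor 2 each: that of log2 sigma >= 1 up to the symbol width, and that of
    the number of symbols per word down to an integer. *)
Lemma log_alphabet_le w sigma n :
  2 <= sigma -> sigma <= 2 ^ w -> 1 <= n -> n <= 2 ^ w ->
  (log sigma n <= 4 * INR (w / Nat.log2_up sigma))%R.
Proof.
  intros Hs Hsw Hn Hnw. set (b := Nat.log2_up sigma).
  assert (Hb1 : 1 <= b) by (apply Nat.log2_up_pos; lia).
  assert (Hbw : b <= w) by (apply Nat.log2_up_le_pow2; lia).
  assert (Hlow : 2 ^ (b - 1) <= sigma).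
  { pose proof (Nat.log2_up_spec sigma ltac:(lia)) as [H _]. fold b in H.
    rewrite <- Nat.sub_1_r in H. lia. }
  pose proof ln2_pos as H2.
  assert (Hln : (INR b * ln 2 <= 2 * ln (INR sigma))%R).
  { pose proof (ln_INR_le _ _ (pow2_pos _) Hlow) as H. rewrite ln_INR_pow2, minus_INR in H by lia.
    pose proof (ln_INR_le 2 sigma ltac:(lia) Hs) as H'. simpl (INR 2) in H'. simpl (INR 1) in H.
    replace (1 + 1)%R with 2%R in H' by lra. lra. }
  pose proof (ln_INR_le n (2 ^ w) Hn Hnw) as Hln'. rewrite ln_INR_pow2 in Hln'.
  assert (Hg1 : 1 <= w / b) by (apply Nat.div_le_lower_bound; lia).
  assert (Hg : (INR w <= 2 * INR (w / b) * INR b)%R).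
  { replace 2%R with (INR 2) by (simpl; lra). rewrite <- !mult_INR. apply le_INR.
    pose proof (Nat.mul_succ_div_gt w b ltac:(lia)). nia. }
  set (g := w / b) in *.
  pose proof (le_INR _ _ Hg1) as Hg1'. simpl in Hg1'.
  pose proof (le_INR _ _ Hb1) as Hb1'. simpl in Hb1'.
  assert (Hpos : (0 < ln (INR sigma))%R) by nra.
  apply Rmax_lub; [lra|].
  apply Rmult_le_reg_r with (ln (INR sigma)); [easy|].
  unfold Rdiv. rewrite Rmult_assoc, Rinv_l, Rmult_1_r by lra.
  apply Rle_trans with (INR w * ln 2)%R; [easy|].
  apply Rle_trans with (2 * INR g * (INR b * ln 2))%R; nra.
Qed.

(** By w < B^3, log_w l is at least a third of log_B l. *)
Lemma level_le_log w beta k l :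
  2 <= w -> w < 2 ^ (3 * beta) -> 1 <= l -> 2 ^ (beta * k) <= l ->
  (INR k <= 3 * log w l)%R.
Proof.
  intros Hw Hb Hl Hk. pose proof ln2_pos as H2.
  assert (H1 : (ln (INR w) <= 3 * INR beta * ln 2)%R).
  { pose proof (ln_INR_le w _ ltac:(lia) (Nat.lt_le_incl _ _ Hb)) as H.
    rewrite ln_INR_pow2, mult_INR in H. simpl (INR 3) in H. lra. }
  assert (H3 : (INR beta * INR k * ln 2 <= ln (INR l))%R).
  { rewrite <- mult_INR, <- ln_INR_pow2. apply ln_INR_le; [apply pow2_pos|easy]. }
  assert (Hpos : (0 < ln (INR w))%R).
  { rewrite <- ln_1. apply ln_increasing; [lra|]. apply (lt_INR 1); lia. }
  apply Rle_trans with (3 * (ln (INR l) / ln (INR w)))%R.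
  - apply Rmult_le_reg_r with (ln (INR w)); [easy|].
    unfold Rdiv. rewrite !Rmult_assoc, Rinv_l, Rmult_1_r by lra.
    pose proof (pos_INR k). nra.
  - apply Rmult_le_compat_l; [lra|]. apply Rmax_r.
Qed.

Theorem theorem7 :
  forall (C : R) (c : nat),
  exists (K : R) (query : prog),
  forall (w sigma : nat) (S : list nat) (P : parse) (alpha : R),
    2 <= w -> length S <= 2 ^ w ->
    2 <= sigma -> sigma <= 2 ^ w -> Forall (fun a => a < sigma) S ->
    is_parse C sigma S P -> valid_parse S P ->
    contracting alpha P -> (alpha <= INR w ^ c)%R ->
    exists M : memory,
      memory_ok w M /\
      (INR (memory_size M) <= K * INR (nphrases P))%R /\
      forall q h l : nat,
        1 <= q <= length S -> height P q h -> longest_repeat S q l ->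
        exists T : nat,
          access w M query S q T /\
          (INR T <= K * (INR h + log w l))%R.
Proof.
  intros C c. destruct (INR_unbounded C) as [A0 HA0].
  (* The 4 comes from [log_alphabet_le]. [D] pays for a copy step. [E] pays for the first search and
     fixed costs: 78 = 2 * 39 per level, at most (A + 6) log_w l levels, and 58 = 39 + 19. *)
  set (A := 4 * A0). set (D := 39 * (3 * c + 2)). set (E := 78 * (A + 6) + 58).
  exists (INR (193 + A + D + E)), query.
  intros w sigma S P alpha Hw HS Hs2 Hsw Hchars (Hfirst & Hlast & Hincr & Hsrc) _ Hcon Halpha.
  set (n := length S) in *. set (t := nphrases P) in *.
  destruct (Nat.eq_dec t 0) as [Ht|Ht].
  (* Without phrases the text is empty, and the size bound 0 forces an empty memory. *)
  { rewrite Ht in Hlast. simpl in Hlast. exists [].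
    split; [constructor|]. split; [rewrite Ht; simpl; lra|]. intros q; lia. }
  set (st := fun i => start P i - 1).
  assert (Hpos : forall i, 1 <= i <= t + 1 -> 1 <= start P i).
  { induction i as [|i IH]; intros Hi; [lia|].
    destruct (Nat.eq_dec i 0) as [->|]; [lia|].
    pose proof (Hincr i ltac:(unfold phrase_index; fold t; lia)) as H.
    rewrite Nat.add_1_r in H. specialize (IH ltac:(lia)). lia. }
  assert (Hst : forall i, 1 <= i <= t + 1 -> start P i = st i + 1).
  { intros i Hi. specialize (Hpos i Hi). unfold st. lia. }
  assert (Hstep : forall i, 1 <= i <= t -> st i < st (i + 1)).
  { intros i Hi. specialize (Hincr i Hi). rewrite !Hst in Hincr by lia. lia. }
  assert (Hlen : forall i, 1 <= i <= t -> phrase_len P i = len st i).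
  { intros i Hi. unfold phrase_len, len. rewrite !Hst by lia. lia. }
  assert (Hn : 1 <= n).
  { pose proof (Hincr 1 ltac:(unfold phrase_index; fold t; lia)).
    pose proof (count_le_n (st (t + 1)) t st eq_refl Hstep) as H'.
    rewrite Hst in Hlast by lia. lia. }
  destruct (block_size_exists w Hw) as (beta & Hb1 & Hb2 & Hb3).
  set (b := Nat.log2_up sigma). set (g := w / b).
  assert (Hb : 1 <= b <= w).
  { split; [apply Nat.log2_up_pos|apply Nat.log2_up_le_pow2]; lia. }
  assert (Hg : 1 <= g /\ g * b <= w).
  { split; [apply Nat.div_le_lower_bound; lia|].
    rewrite Nat.mul_comm. apply Nat.Div0.mul_div_le. }
  assert (Hsources : forall i, 1 <= i <= t ->
    match source P i with
    | None => len st i <= A * g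
    | Some p => same_substring S p (start P i) (len st i)
    end).
  { intros i Hi. specialize (Hsrc i Hi). rewrite (Hlen i Hi) in Hsrc.
    destruct (source P i); [easy|]. apply INR_le. unfold A.
    rewrite !mult_INR. simpl (INR 4).
    pose proof (log_alphabet_le w sigma n Hs2 Hsw Hn HS) as Hlog. fold b g in Hlog.
    pose proof (log_ge_1 sigma n). pose proof (pos_INR A0). nra. }
  destruct (structure_exists w n t beta st) with (text := S) (P := P) (b := b) (g := g)
    (A := A) (c := c) as (M & HM & Hsize & Hquery); try easy; try lia.
  - unfold st. lia.
  - unfold st. lia.
  - revert Hchars. apply Forall_impl. intros x Hx.
    apply Nat.lt_le_trans with sigma; [easy|]. apply Nat.log2_log2_up_spec. lia.
  - intros i p j r Hi Hp Hj Hr Hin. apply INR_le. rewrite mult_INR, pow_INR.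
    rewrite <- !Hlen by easy.
    apply Rle_trans with (alpha * INR (phrase_len P i))%R.
    + apply (Hcon i p j r Hi Hp Hj); [|easy]. now rewrite Hlen.
    + apply Rmult_le_compat_r; [apply pos_INR|easy].
  - exists M. split; [easy|]. split.
    + rewrite <- mult_INR. apply le_INR. fold t. nia.
    + intros q h l Hq Hh [Hmax _]. fold n in Hq.
      assert (Hi : exists i, contains t st i (q - 1)).
      { apply (contains_exists w n t beta st); try easy; try lia; unfold st; lia. }
      destruct Hi as [i Hi].
      destruct (Hquery q h i Hq Hh Hi) as (T & HT & Hle). exists T. split; [easy|].
      pose proof (log_ge_1 w l) as Hlog.
      assert (Hlevel : (INR (level beta st i) <= INR (A + 6) * log w l)%R).
      { pose proof (width_level_le w n t beta st) as Hwidth.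
        specialize (Hwidth HS ltac:(lia) ltac:(unfold st; lia) ltac:(unfold st; lia) Hb1 Hb2 i).
        unfold width in Hwidth. rewrite plus_INR. simpl (INR 6). pose proof (pos_INR A).
        pose proof (Hsources i (proj1 Hi)) as Hs.
        destruct (source P i) as [p|] eqn:Hp.
        - assert (Hil : 1 <= len st i <= l).
          { pose proof (proj1 Hi) as Hit. pose proof (Hstep i Hit). pose proof (Hst i ltac:(lia)).
            assert (Hli : len st i = st (i + 1) - st i) by easy.
            split; [lia|].
            replace (len st i) with (start P i + len st i - 1 + 1 - start P i) by lia.
            apply Hmax; [destruct Hi; lia|]. split; [lia|]. exists p. split.
            (* A phrase copied from its own place would make [q] a fixed point of [parse_step]
               outside the explicit phrases, contradicting its height. So the source is a second
               occurrence. *)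
            - intros ->. destruct Hh as [Hexp _].
              assert (Hq1 : phrase_of P q = i).
              { replace q with (q - 1 + 1) by lia.
                apply (phrase_of_contains w n t beta st); try easy; try lia; unfold st; lia. }
              assert (Hfix : Nat.iter h (parse_step P) q = q).
              { clear - Hp Hq1 Hq. induction h as [|h IH]; [easy|]. simpl. rewrite IH.
                unfold parse_step. rewrite Hq1, Hp. lia. }
              rewrite Hfix in Hexp. unfold explicit_pos in Hexp. congruence.
            - destruct Hs as (? & ? & ? & ? & Heq).
              replace (start P i + len st i - 1 + 1 - start P i) with (len st i) by lia.
              repeat split; try easy. intros k Hk. symmetry. now apply Heq. }
          pose proof (level_le_log w beta (level beta st i) l Hw Hb3 ltac:(lia) ltac:(lia)). nra.
        (* An explicit phrase need not repeat, but its length is at most A * w <= 2^(beta A) * 2^(3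
           beta). Its bounded level is absorbed by the convention that logarithms are at least 1. *)
        - assert (Hi3 : level beta st i <= A + 3).
          { apply (Nat.mul_le_mono_pos_l _ _ beta); [lia|].
            apply (Nat.pow_le_mono_r_iff 2); [lia|].
            pose proof (Nat.pow_gt_lin_r 2 A ltac:(lia)).
            rewrite Nat.mul_add_distr_l, Nat.pow_add_r, (Nat.mul_comm beta 3).
            assert (2 ^ A <= 2 ^ (beta * A)) by (apply Nat.pow_le_mono_r; nia).
            assert (A * g <= A * w) by nia.
            assert (A * w <= 2 ^ (beta * A) * 2 ^ (3 * beta)) by nia. nia. }
          apply le_INR in Hi3. rewrite plus_INR in Hi3. simpl (INR 3) in Hi3. nra. }
      assert (HT' : (INR T <= 78 * INR (level beta st i) + 58 + INR D * INR h)%R).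
      { apply Rle_trans with (INR (78 * level beta st i + 58 + D * h)).
        - apply le_INR. unfold D. lia.
        - rewrite !plus_INR, !mult_INR. apply Req_le. repeat f_equal; simpl; lra. }
      assert (HE : INR E = (78 * INR (A + 6) + 58)%R).
      { unfold E. rewrite plus_INR, mult_INR. f_equal; [f_equal|]; simpl; lra. }
      rewrite (plus_INR _ E), (plus_INR _ D), HE. rewrite plus_INR.
      pose proof (pos_INR h). pose proof (pos_INR D). pose proof (pos_INR A).
      pose proof (pos_INR (A + 6)). pose proof (pos_INR 193).
      set (Lg := log w l) in *. set (lv := INR (level beta st i)) in *.
      set (a6 := INR (A + 6)) in *. set (k := INR 193) in *.
      assert (0 <= (k + INR A) * (INR h + Lg))%R by (apply Rmult_le_pos; lra).
      assert (0 <= INR D * Lg)%R by (apply Rmult_le_pos; lra).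
      assert (0 <= a6 * INR h)%R by (apply Rmult_le_pos; lra).
      lra.
Qed.
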